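(* Let $E$ be a Banach lattice satisfying the lower $2$-estimate with constant $M$. Then $(E\otimes_{|\pi|}E)/I_{\rm oc}$ is lattice isomorphic to an AL-space. If $M=1$ then $(E\otimes_{|\pi|}E)/I_{\rm oc}$ is an AL-space.
   Context: All Banach lattices are real. A Banach lattice $E$ satisfies the lower $2$-estimate with constant $M>0$ if $\bigl\|\sum_{k=1}^n x_k\bigr\|\ge\frac1M\bigl(\sum_{k=1}^n\|x_k\|^2\bigr)^{1/2}$ whenever $x_1,\dots,x_n\in E$ are (pairwise) disjoint. An AL-space is a Banach lattice with $\|x+y\|=\|x\|+\|y\|$ for all $x,y\ge 0$ (the zero space is allowed). Fremlin tensor product: for Banach lattices $E,F$, the norm of $u$ in the algebraic tensor product $E\otimes F$ is $\|u\|_{|\pi|}=\sup\|\hat\varphi(u)\|$, where the supremum is over all Banach lattices $G$ and all positive bilinear maps $\varphi\colon E\times F\to G$ (i.e. $\varphi(x,y)\ge 0$ whenever $x,y\ge 0$) with $\|\varphi\|=\sup\{\|\varphi(x,y)\|:\|x\|\le1,\|y\|\le1\}\le 1$, and $\hat\varphi$ is the induced linear map on $E\otimes F$. The completion of $E\otimes F$ in this norm is a Banach lattice (its positive cone is the closure of the convex cone generated by $x\otimes y$ with $x,y\ge0$), denoted $E\otimes_{|\pi|}F$. It has the universal property that continuous positive bilinear maps $\varphi\colon E\times F\to G$ correspond one-to-one and norm-preservingly to positive operators $T\colon E\otimes_{|\pi|}F\to G$ with $T(x\otimes y)=\varphi(x,y)$; $T$ is a lattice homomorphism if and only if $|\varphi(x,y)|=\varphi(|x|,|y|)$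 for all $x,y$. $I_{\rm oc}$ denotes the norm closed order ideal of $E\otimes_{|\pi|}E$ generated by $\{x\otimes y : x,y\in E,\ x\perp y\}$. The quotient $(E\otimes_{|\pi|}E)/I_{\rm oc}$ carries the quotient norm and quotient order. *)

(* Defs.v *)
From HB Require Import structures.
From mathcomp Require Import all_boot all_order all_algebra.
From mathcomp Require Import all_classical all_reals all_analysis.

Set Implicit Arguments.
Unset Strict Implicit.
Unset Printing Implicit Defensive.

Import Order.TTheory GRing.Theory Num.Theory.
Import numFieldNormedType.Exports.

Local Open Scope classical_set_scope.
Local Open Scope ring_scope.

(* The order is carried by this mixin and not by an Order.* structure: the
   hierarchy already joins orders and norms in numDomainType, and Hierarchy
   Builder then admits no other class that inherits both. *)
HB.mixin Record isBanachLattice (R : realType) T & CompleteNormedModule R T := {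
  vle : T -> T -> Prop;
  vsup : T -> T -> T;
  vle_refl : forall x : T, vle x x;
  vle_anti : forall x y : T, vle x y -> vle y x -> x = y;
  vle_trans : forall y x z : T, vle x y -> vle y z -> vle x z;
  vsup_lub : forall x y z : T, vle (vsup x y) z <-> vle x z /\ vle y z;
  vleD2r : forall z x y : T, vle x y -> vle (x + z) (y + z);
  vleZ : forall (a : R) (x y : T), 0 <= a -> vle x y -> vle (a *: x) (a *: y);
  vnorm_mono : forall x y : T,
    vle (vsup x (- x)) (vsup y (- y)) -> `|x| <= `|y|
}.

#[short(type="banachLatticeType")]
HB.structure Definition BanachLattice (R : realType) :=
  {T of CompleteNormedModule R T & isBanachLattice R T}.

Declare Scope vlattice_scope.
Delimit Scope vlattice_scope with VL.
Notation "x <=v y" := (vle x y) (at level 70, no associativity) : vlattice_scope.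
Local Open Scope vlattice_scope.

Section VectorLattice.
Context {R : realType} {E : banachLatticeType R}.
Implicit Types x y z : E.

Definition vinf x y : E := - vsup (- x) (- y).
Definition vabs x : E := vsup x (- x).
Definition disjoint x y : Prop := vinf (vabs x) (vabs y) = 0.

Lemma vle_supl x y : x <=v vsup x y.
Proof. by have [] := (vsup_lub x y _).1 (vle_refl _). Qed.

Lemma vle_supr x y : y <=v vsup x y.
Proof. by have [] := (vsup_lub x y _).1 (vle_refl _). Qed.

Lemma vsup_le x y z : x <=v z -> y <=v z -> vsup x y <=v z.
Proof. by move=> xz yz; apply/vsup_lub. Qed.

Lemma vsupC x y : vsup x y = vsup y x.
Proof.
by apply: vle_anti; apply: vsup_le; by [apply: vle_supl|apply: vle_supr].
Qed.

Lemma vleD x y x' y' : x <=v y -> x' <=v y' -> x + x' <=v y + y'.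
Proof.
move=> xy x'y'; apply: (vle_trans (y + x')); first exact: vleD2r.
by rewrite ![y + _]addrC; apply: vleD2r.
Qed.

Lemma vle_sub0 x y : 0 <=v y - x <-> x <=v y.
Proof.
by split=> [/(vleD2r x)|/(vleD2r (- x))]; rewrite ?subrr// add0r subrK.
Qed.

Lemma vleN x y : x <=v y -> - y <=v - x.
Proof. by move=> /vle_sub0 xy; apply/vle_sub0; rewrite opprK addrC. Qed.

Lemma vle_infl x y : vinf x y <=v x.
Proof. by rewrite -[X in _ <=v X]opprK; apply: vleN; apply: vle_supl. Qed.

Lemma vle_infr x y : vinf x y <=v y.
Proof. by rewrite -[X in _ <=v X]opprK; apply: vleN; apply: vle_supr. Qed.

Lemma vle_abs x : x <=v vabs x. Proof. exact: vle_supl. Qed.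

Lemma vleN_abs x : - x <=v vabs x. Proof. exact: vle_supr. Qed.

Lemma vabsN x : vabs (- x) = vabs x.
Proof. by rewrite /vabs opprK vsupC. Qed.

Lemma vabs_ge0 x : 0 <=v vabs x.
Proof.
have x2 : 0 <=v vabs x *+ 2.
  by rewrite mulr2n -(subrr x); apply: vleD; [exact: vle_abs|exact: vleN_abs].
have := vleZ (2^-1) _ _ _ x2; rewrite scaler0 -scalerMnr scalerMnl.
by rewrite -[2^-1 *+ 2]mulr_natr mulVf// scale1r; apply; rewrite invr_ge0.
Qed.

Lemma ge0_vabs x : 0 <=v x -> vabs x = x.
Proof.
move=> x0; apply: vle_anti; last exact: vle_abs.
apply: vsup_le; first exact: vle_refl.
by apply: (vle_trans 0) => //; rewrite -oppr0; apply: vleN.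
Qed.

Lemma vabs_le x y : x <=v y -> - x <=v y -> vabs x <=v y.
Proof. exact: vsup_le. Qed.

Lemma vsup_diff_le x y x' y' :
  vsup x y - vsup x' y' <=v vabs (x - x') + vabs (y - y').
Proof.
have h a a' b b' : a <=v vsup a' b' + (vabs (a - a') + vabs (b - b')).
  rewrite -[X in X <=v _](subrK a') addrC; apply: vleD; first exact: vle_supl.
  rewrite -[X in X <=v _]addr0; apply: vleD; first exact: vle_abs.
  exact: vabs_ge0.
apply/vle_sub0; rewrite opprB addrA; apply/vle_sub0; rewrite addrC.
apply: vsup_le; first exact: h.
by rewrite vsupC [vabs (x - x') + _]addrC; apply: h.
Qed.

Lemma norm_vabs x : `|vabs x| = `|x|.
Proof.
have e : vabs (vabs x) = vabs x by exact/ge0_vabs/vabs_ge0.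
have h y z : vabs y = vabs z -> `|y| <= `|z|.
  by rewrite /vabs => yz; apply: vnorm_mono; rewrite yz; apply: vle_refl.
by apply/eqP; rewrite eq_le !h.
Qed.

End VectorLattice.

Section ClosedIdeals.
Context {R : realType} {E : banachLatticeType R}.

Definition order_ideal (I : set E) : Prop :=
  [/\ I 0,
      forall (a : R) x y, I x -> I y -> I (a *: x + y) &
      forall x y, vabs x <=v vabs y -> I y -> I x].

Record closedIdeal := ClosedIdeal {
  ideal_set :> set E;
  ideal_order : order_ideal ideal_set;
  ideal_closed : closed ideal_set
}.

Definition closed_ideal_hull (A : set E) : set E :=
  \bigcap_(J in [set J | [/\ order_ideal J, closed J & A `<=` J]]) J.

Lemma closed_ideal_hull_order A : order_ideal (closed_ideal_hull A).
Proof.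
split.
- by move=> J [[]].
- by move=> a x y Ix Iy J HJ; have [[_ h _] _ _] := HJ; exact: h (Ix J HJ) (Iy J HJ).
- by move=> x y xy Iy J HJ; have [[_ _ h] _ _] := HJ; exact: h xy (Iy J HJ).
Qed.

Lemma closed_ideal_hull_closed A : closed (closed_ideal_hull A).
Proof. by apply: closed_bigI => J []. Qed.

(* The smallest closed order ideal that contains A. *)
Definition closed_ideal_gen (A : set E) : closedIdeal :=
  ClosedIdeal (closed_ideal_hull_order A) (@closed_ideal_hull_closed A).

End ClosedIdeals.
Arguments closedIdeal {R} E.

Section Quotient.
Context {R : realType} {E : banachLatticeType R}.
Variable I : closedIdeal E.

Definition ideal_pred : {pred E} := fun x => `[< ideal_set I x >].

Lemma ideal_predP x : reflect (ideal_set I x) (x \in ideal_pred).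
Proof. exact: asboolP. Qed.

Fact ideal_pred_zmod : zmod_closed ideal_pred.
Proof.
have [I0 Il _] := ideal_order I; split; first exact/ideal_predP.
move=> x y /ideal_predP Ix /ideal_predP Iy; apply/ideal_predP.
by rewrite addrC -scaleN1r; apply: Il.
Qed.

HB.instance Definition _ := GRing.isZmodClosed.Build E ideal_pred ideal_pred_zmod.

Definition bl_quot : Type := Quotient.quot ideal_pred.

HB.instance Definition _ := GRing.Zmodule.on bl_quot.
HB.instance Definition _ := ZmodQuotient.on bl_quot.

Definition quot_map (x : E) : bl_quot := \pi_bl_quot%qT x.
Local Notation pi := quot_map.

Implicit Types (x y : E) (p q : bl_quot).

Let piD x y : pi (x + y) = pi x + pi y. Proof. exact: raddfD. Qed.
Let piB x y : pi (x - y) = pi x - pi y. Proof. exact: raddfB. Qed.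
Let piN x : pi (- x) = - pi x. Proof. exact: raddfN. Qed.
Let pi0 : pi 0 = 0. Proof. exact: raddf0. Qed.

Lemma quot_mapK q : exists x, pi x = q.
Proof. by exists (repr q); exact: reprK. Qed.

Lemma quot_map_eq x y : pi x = pi y <-> ideal_set I (x - y).
Proof.
split=> [e|/ideal_predP]; last by rewrite Quotient.idealrBE => /eqP.
by apply/ideal_predP; rewrite Quotient.idealrBE; apply/eqP.
Qed.

Lemma quot_map_eq0 x : pi x = 0 <-> ideal_set I x.
Proof. by rewrite -pi0 quot_map_eq subr0. Qed.

Let idealZ (a : R) x : ideal_set I x -> ideal_set I (a *: x).
Proof.
have [I0 Il _] := ideal_order I.
by move=> Ix; rewrite -[_ *: _]addr0; apply: Il.
Qed.

Let idealD x y : ideal_set I x -> ideal_set I y -> ideal_set I (x + y).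
Proof.
have [_ Il _] := ideal_order I.
by move=> Ix Iy; rewrite -[x]scale1r; apply: Il.
Qed.

Let ideal_abs x : ideal_set I x -> ideal_set I (vabs x).
Proof.
have [_ _ Is] := ideal_order I; apply: Is.
by rewrite (ge0_vabs (vabs_ge0 x)); exact: vle_refl.
Qed.

Let ideal_solid x y : vabs x <=v y -> ideal_set I y -> ideal_set I x.
Proof.
have [_ _ Is] := ideal_order I; move=> xy; apply: Is.
by rewrite (ge0_vabs (vle_trans _ _ _ (vabs_ge0 x) xy)).
Qed.

Definition quot_scale (a : R) q : bl_quot := pi (a *: repr q).

Let pi_repr q : pi (repr q) = q. Proof. exact: reprK. Qed.

Let piZ (a : R) x : pi (a *: x) = quot_scale a (pi x).
Proof.
by apply/quot_map_eq; rewrite -scalerBr; apply/idealZ/quot_map_eq; rewrite pi_repr.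
Qed.

Fact quot_scalerA a b q : quot_scale a (quot_scale b q) = quot_scale (a * b) q.
Proof. by rewrite -[q]pi_repr -!piZ scalerA. Qed.
Fact quot_scale1r : left_id 1 quot_scale.
Proof. by move=> q; rewrite -[q]pi_repr -!piZ scale1r. Qed.
Fact quot_scalerDr : right_distributive quot_scale +%R.
Proof.
move=> a p q; rewrite -[p]pi_repr -[q]pi_repr.
by rewrite -piD -!piZ scalerDr piD.
Qed.
Fact quot_scalerDl q : {morph quot_scale^~ q : a b / a + b}.
Proof. by move=> a b; rewrite -[q]pi_repr -!piZ scalerDl piD. Qed.

HB.instance Definition _ := GRing.Zmodule_isLmodule.Build R bl_quot
  quot_scalerA quot_scale1r quot_scalerDr quot_scalerDl.

Fact quot_map_linear : linear quot_map.
Proof. by move=> a x y; rewrite piD piZ. Qed.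
HB.instance Definition _ :=
  GRing.isLinear.Build R E bl_quot *:%R quot_map quot_map_linear.

Definition quot_norm q : R := inf [set `|x| | x in [set x | pi x = q]].

Let quot_norm_le x : quot_norm (pi x) <= `|x|.
Proof. by apply: ge_inf; [exists 0 => _ [y _ <-]|exists x]. Qed.

Let quot_norm_ge0 q : 0 <= quot_norm q.
Proof.
apply: lb_le_inf; last by move=> _ [y _ <-].
by exists `|repr q|, (repr q).
Qed.

Let quot_norm_lift q (e : R) : 0 < e -> exists2 x, pi x = q & `|x| < quot_norm q + e.
Proof.
move=> e0; have [|_ [x xq <-] xe] := @inf_adherent _ [set `|x| | x in [set x | pi x = q]] e e0.
  split; first by exists `|repr q|, (repr q).
  by exists 0 => _ [y _ <-].
by exists x.
Qed.

Fact quot_ler_normD p q : quot_norm (p + q) <= quot_norm p + quot_norm q.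
Proof.
apply/ler_addgt0Pr => e e0; have e20 : 0 < e / 2 by rewrite divr_gt0.
have [x <- /ltW xe] := quot_norm_lift p e20.
have [y <- /ltW ye] := quot_norm_lift q e20.
rewrite -piD (le_trans (quot_norm_le _))// (le_trans (ler_normD _ _))//.
by rewrite [e]splitr addrACA lerD.
Qed.

Let quot_normZ_le a q : quot_norm (a *: q) <= `|a| * quot_norm q.
Proof.
apply/ler_addgt0Pr => e e0.
have a0 : 0 < `|a| + 1 by rewrite ltr_wpDl.
have [x <- /ltW xe] := quot_norm_lift q (divr_gt0 e0 a0).
have -> : a *: pi x = pi (a *: x) by rewrite piZ.
rewrite (le_trans (quot_norm_le _))// normrZ.
rewrite (le_trans (ler_wpM2l _ xe))// mulrDr lerD2l mulrCA ger_pMr//.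
by rewrite ler_pdivrMr// mul1r lerDl.
Qed.

Fact quot_normrZ a q : quot_norm (a *: q) = `|a| * quot_norm q.
Proof.
apply/eqP; rewrite eq_le quot_normZ_le/=; have [->|a0] := eqVneq a 0.
  by rewrite normr0 mul0r quot_norm_ge0.
rewrite -[q in leLHS]scale1r -(mulVf a0) -scalerA.
rewrite (le_trans (ler_wpM2l _ (quot_normZ_le _ _)))// normfV mulrA.
by rewrite divff ?normr_eq0// mul1r.
Qed.

Fact quot_normr0_eq0 q : quot_norm q = 0 -> q = 0.
Proof.
move=> q0; rewrite -[q]pi_repr; apply/quot_map_eq0; apply: ideal_closed.
move=> B /nbhs_ballP[e /= e0 eB].
have [x xq] := quot_norm_lift q e0; rewrite q0 add0r => xe.
exists (repr q - x); split; first by apply/quot_map_eq; rewrite pi_repr.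
by apply: eB; rewrite -ball_normE /= opprB addrC subrK.
Qed.

HB.instance Definition _ := @Lmodule_isNormed.Build R bl_quot
  quot_norm quot_ler_normD quot_normrZ quot_normr0_eq0.


Let norm_quot_map x : `|quot_map x| <= `|x|. Proof. exact: quot_norm_le. Qed.

Let norm_quot_lift q (e : R) : 0 < e -> exists2 x, pi x = q & `|x| < `|q| + e.
Proof. exact: quot_norm_lift. Qed.

Fact quot_cauchy_cvg (F : set_system bl_quot) :
  ProperFilter F -> cauchy F -> cvg F.
Proof.
move=> FF /cauchyP Fc.
have /choice[c cF] n : exists q, F (ball q (2^-1 ^+ n)) by apply: Fc; rewrite exprn_gt0.
have cc n : `|c n.+1 - c n| <= 2 * 2^-1 ^+ n.
  have [z [zn zn1]] := filter_ex (filterI (cF n) (cF n.+1)).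
  move: zn zn1; rewrite -!ball_normE /= => zn zn1.
  rewrite -(subrK z (c n.+1)) -addrA (le_trans (ler_normD _ _))//.
  rewrite mulrDl mul1r lerD//.
    by rewrite (le_trans (ltW zn1))// exprS ger_pMl ?exprn_gt0// invf_le1// ler1n.
  by rewrite distrC ltW.
have /choice[d /all_and2[dc dn]] n : exists x, pi x = c n.+1 - c n /\
    `|x| <= 3 * 2^-1 ^+ n.
  have h0 : 0 < (2^-1 : R) ^+ n by rewrite exprn_gt0.
  have [x xE xn] := norm_quot_lift (c n.+1 - c n) h0.
  exists x; split=> //; apply: (le_trans (ltW xn)).
  by rewrite -[3%:R](natr1 2) mulrDl mul1r lerD2r.
have ds : cvgn (series d).
  apply: normed_cvg; apply: (@series_le_cvg _ _ (geometric 3 2^-1)).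
  - by move=> n; exact: normr_ge0.
  - by move=> n; rewrite /geometric/= mulr_ge0// exprn_ge0.
  - exact: dn.
  - by apply: is_cvg_geometric_series; rewrite gtr0_norm// invf_lt1// ltr1n.
have xc n : pi (repr (c 0) + series d n) = c n.
  elim: n => [|n IH]; first by rewrite /series/= big_geq// addr0 pi_repr.
  by rewrite seriesSr addrA piD IH dc addrC subrK.
apply/cvg_ex; exists (pi (repr (c 0) + lim (series d @ \oo))).
apply/cvg_ballP => e e0.
have e20 : 0 < e / 2 by rewrite divr_gt0.
near \oo => n; apply: filterS (cF n) => y; rewrite -!ball_normE /= => yn.
rewrite -(subrK (c n) (pi _)) -addrA (le_lt_trans (ler_normD _ _))//.
rewrite [e]splitr ltrD//.
  rewrite -(xc n) -piB (le_lt_trans (norm_quot_map _))//.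
  rewrite opprD addrACA subrr add0r.
  by near: n; move/cvgrPdist_lt: ds; apply.
apply: (lt_trans yn); near: n.
have := @cvg_expr R 2^-1; rewrite gtr0_norm// invf_lt1// ltr1n => /(_ isT).
by move=> /cvgrPdist_lt/(_ _ e20); apply: filterS => n; rewrite sub0r normrN ger0_norm// exprn_ge0.
Unshelve. all: by end_near. Qed.

HB.instance Definition _ := Uniform_isComplete.Build bl_quot quot_cauchy_cvg.

Definition quot_le p q : Prop := exists2 z, 0 <=v z & pi z = q - p.
Definition quot_sup p q : bl_quot := pi (vsup (repr p) (repr q)).

Let quot_le_map x y : x <=v y -> quot_le (pi x) (pi y).
Proof. by move=> /vle_sub0 xy; exists (y - x). Qed.

Let quot_sup_map x y : quot_sup (pi x) (pi y) = pi (vsup x y).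
Proof.
set x' := repr (pi x); set y' := repr (pi y).
have ix : ideal_set I (x' - x) by apply/quot_map_eq; rewrite pi_repr.
have iy : ideal_set I (y' - y) by apply/quot_map_eq; rewrite pi_repr.
apply/quot_map_eq.
apply: ideal_solid (idealD (ideal_abs ix) (ideal_abs iy)).
apply: vabs_le; first exact: vsup_diff_le.
rewrite opprB -[x' - x]opprB -[y' - y]opprB !vabsN; exact: vsup_diff_le.
Qed.

Fact quot_le_refl p : quot_le p p.
Proof. by exists 0; [exact: vle_refl|rewrite subrr]. Qed.

Fact quot_le_trans q p s : quot_le p q -> quot_le q s -> quot_le p s.
Proof.
move=> [z z0 zE] [w w0 wE]; exists (w + z).
  by rewrite -[0]addr0; apply: vleD.
by rewrite piD zE wE addrA subrK.
Qed.

Fact quot_le_anti p q : quot_le p q -> quot_le q p -> p = q.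
Proof.
move=> [z z0 zE] [w w0 wE].
have zw : ideal_set I (z + w).
  by apply/quot_map_eq0; rewrite piD zE wE addrA subrK subrr.
have zI : ideal_set I z.
  apply: ideal_solid zw; rewrite (ge0_vabs z0) -[X in X <=v _]addr0.
  by apply: vleD => //; exact: vle_refl.
by move: zE; rewrite (quot_map_eq0 z).2// => /esym/eqP; rewrite subr_eq0 => /eqP.
Qed.

Fact quot_leD2r s p q : quot_le p q -> quot_le (p + s) (q + s).
Proof. by move=> [z z0 zE]; exists z => //; rewrite zE opprD addrACA subrr addr0. Qed.

Fact quot_leZ (a : R) p q : 0 <= a -> quot_le p q -> quot_le (a *: p) (a *: q).
Proof.
move=> a0 [z z0 zE]; exists (a *: z); last by rewrite linearZ/= zE scalerBr.
by rewrite -(scaler0 _ a); apply: vleZ.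
Qed.

Fact quot_sup_lub p q s : quot_le (quot_sup p q) s <-> quot_le p s /\ quot_le q s.
Proof.
rewrite -[p]pi_repr -[q]pi_repr; set x := repr p; set y := repr q.
rewrite quot_sup_map; split=> [h|[[z z0 zE] [w w0 wE]]].
  by split; apply: quot_le_trans h; apply: quot_le_map;
    [exact: vle_supl|exact: vle_supr].
have zs : pi (x + z) = s by rewrite piD zE addrC subrK.
have ws : pi (y + w) = s by rewrite piD wE addrC subrK.
have <- : pi (vsup (x + z) (y + w)) = s.
  rewrite -quot_sup_map ws -zs quot_sup_map; congr pi.
  by apply: vle_anti; [apply: vsup_le; exact: vle_refl|exact: vle_supl].
apply: quot_le_map; apply: vsup_le.
  apply: (vle_trans _ _ _ _ (vle_supl _ _)).
  by rewrite -[X in X <=v _]addr0; apply: vleD => //; exact: vle_refl.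
apply: (vle_trans _ _ _ _ (vle_supr _ _)).
by rewrite -[X in X <=v _]addr0; apply: vleD => //; exact: vle_refl.
Qed.

Fact quot_norm_mono p q :
  quot_le (quot_sup p (- p)) (quot_sup q (- q)) -> `|p| <= `|q|.
Proof.
move=> pq; apply/ler_addgt0Pr => e e0.
have [y yq /ltW ye] := norm_quot_lift q e0.
apply: le_trans ye; set x := repr p; set a := vabs y.
have xp : pi x = p by exact: pi_repr.
have pa : pi a = quot_sup q (- q) by rewrite -yq -piN quot_sup_map.
have /quot_sup_lub[pa1 pa2] : quot_le (quot_sup p (- p)) (pi a) by rewrite pa.
have sup_le_eq s s' : quot_le s' s -> quot_sup s s' = s.
  move=> h; apply: quot_le_anti.
    by apply/quot_sup_lub; split=> //; exact: quot_le_refl.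
  by have [] := (quot_sup_lub s s' _).1 (quot_le_refl _).
have leN s s' : quot_le s s' -> quot_le (- s') (- s).
  by move=> [z z0 zE]; exists z => //; rewrite zE opprK addrC.
pose x' := vsup (vinf x a) (- a).
have <- : pi x' = p.
  rewrite -quot_sup_map /vinf !piN -quot_sup_map !piN xp (sup_le_eq (- p)) ?opprK; last exact: (leN _ _ pa1).
  by apply: sup_le_eq; rewrite -[p]opprK; exact: (leN _ _ pa2).
apply: (le_trans (norm_quot_map _)); rewrite -(norm_vabs y) -/a.
have a0 : 0 <=v a by exact: vabs_ge0.
apply: vnorm_mono; rewrite -/(vabs x') -/(vabs a) (ge0_vabs a0).
apply: vabs_le.
  apply: vsup_le; first exact: vle_infr.
  by apply: (vle_trans 0) => //; rewrite -oppr0; apply: vleN.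
by rewrite -[X in _ <=v X]opprK; apply: vleN; apply: vle_supr.
Qed.

HB.instance Definition _ := isBanachLattice.Build R bl_quot
  quot_le_refl quot_le_anti quot_le_trans quot_sup_lub quot_leD2r quot_leZ
  quot_norm_mono.

Lemma quot_map_vsup x y :
  quot_map (vsup x y) = vsup (quot_map x) (quot_map y).
Proof. by rewrite -quot_sup_map. Qed.

Lemma quot_vleE p q : p <=v q <-> exists2 z, 0 <=v z & quot_map z = q - p.
Proof. by []. Qed.

Lemma quot_normE q : `|q| = inf [set `|x| | x in [set x | quot_map x = q]].
Proof. by []. Qed.

End Quotient.
Arguments bl_quot {R E} I.

Definition AL_space (R : realType) (E : banachLatticeType R) : Prop :=
  forall x y : E, 0 <=v x -> 0 <=v y -> `|x + y| = `|x| + `|y|.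

Definition lattice_isomorphic (R : realType) (E F : banachLatticeType R) : Prop :=
  exists (f : {linear E -> F}) (g : F -> E),
    [/\ cancel f g, cancel g f, {morph f : x y / vsup x y},
        continuous f & continuous g].

Definition lower_2_estimate (R : realType) (E : banachLatticeType R) (M : R) : Prop :=
  forall (n : nat) (x : 'I_n -> E),
    (forall i j, i != j -> disjoint (x i) (x j)) ->
    M^-1 * Num.sqrt (\sum_(i < n) `|x i| ^+ 2) <= `|\sum_(i < n) x i|.

Section FremlinTensor.
Context {R : realType}.

Definition positive_bilinear (E F G : banachLatticeType R)
    (phi : {bilinear E -> F -> G}) : Prop :=
  forall x y, 0 <=v x -> 0 <=v y -> 0 <=v phi x y.

Definition bilinear_norm (E F G : banachLatticeType R)
    (phi : {bilinear E -> F -> G}) : \bar R :=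
  ereal_sup [set r | exists x y,
    [/\ `|x| <= 1, `|y| <= 1 & r = `|phi x y|%:E]].

(* The list [:: (x_1, y_1); ...; (x_n, y_n)] stands for the element
   x_1 (x) y_1 + ... + x_n (x) y_n of the algebraic tensor product. *)
Definition bilinear_sum (E F G : banachLatticeType R)
    (phi : {bilinear E -> F -> G}) (u : seq (E * F)) : G :=
  \sum_(p <- u) phi p.1 p.2.

Definition fremlin_norm (E F : banachLatticeType R) (u : seq (E * F)) : \bar R :=
  ereal_sup [set r | exists (G : banachLatticeType R) (phi : {bilinear E -> F -> G}),
    [/\ positive_bilinear phi, (bilinear_norm phi <= 1)%E &
        r = `|bilinear_sum phi u|%:E]].

Definition conic_hull (T : banachLatticeType R) (A : set T) : set T :=
  [set v | exists s : seq (R * T),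
    (forall p, p \in s -> 0 <= p.1 /\ A p.2) /\
    v = \sum_(p <- s) p.1 *: p.2].

(* t exhibits T as the completion of the algebraic tensor product for the
   norm fremlin_norm.  Two lists that represent the same algebraic tensor have
   difference of norm 0 and hence the same image in T. *)
Record fremlin_tensor (E F T : banachLatticeType R) (t : {bilinear E -> F -> T}) :
    Prop := FremlinTensor {
  fremlin_isometry : forall u : seq (E * F),
    (`|bilinear_sum t u|%:E = fremlin_norm u)%E;
  fremlin_dense : closure (range (bilinear_sum t)) = setT;
  fremlin_cone : [set v : T | 0 <=v v] =
    closure (conic_hull [set t x y | x in [set x | 0 <=v x] & y in [set y | 0 <=v y]])
}.

Definition Ioc (E T : banachLatticeType R) (t : {bilinear E -> E -> T}) :
    closedIdeal T :=
  closed_ideal_gen [set v | exists x y, disjoint x y /\ v = t x y].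

End FremlinTensor.

(* Main.v *)
(* A positive bilinear form phi on E that vanishes on disjoint pairs induces a
   positive functional on the quotient Q of the tensor square.  With
   b(x, y) the class of x (x) y in Q and C = M^2, take for phi the variation
     phi(x, y) = C^-1 sup sum_ij ||b(x_i, y_j)||,
   over all partitions of x and y into positive summands.  It is biadditive on
   the cone and dominates C^-1 ||b||; once phi(x, y) <= ||x|| ||y|| is known, the
   definition of the Fremlin norm turns phi into a functional F with
   C^-1 ||p|| <= F(p) <= ||p|| for p >= 0 in Q, and F(|p|) is the required
   AL-norm, equal to ||p|| if M = 1.

   The bound on phi is where the lower 2-estimate enters.  If all x_i and y_j
   were combinations of the same disjoint w_k, then orthosymmetry would give
     sum_ij ||b(x_i, y_j)|| <= sum_k a_k b_k ||w_k||^2, x = sum_k a_k w_k,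
   y = sum_k b_k w_k, and Cauchy-Schwarz and the lower 2-estimate would finish.
   In general the lower 2-estimate makes the band truncations x /\ n h norm
   convergent, so that a finite family can be cut along bands until each piece
   is nearly proportional to one element. *)

From HB Require Import structures.
Require Import Defs.
From mathcomp Require Import all_boot all_order all_algebra.
From mathcomp Require Import all_classical all_reals all_analysis.
From mathcomp Require Import ring lra.
Import Order.TTheory GRing.Theory Num.Theory.
Import numFieldNormedType.Exports.
Set Implicit Arguments.
Unset Strict Implicit.
Unset Printing Implicit Defensive.
Local Open Scope classical_set_scope.
Local Open Scope ring_scope.
Local Open Scope vlattice_scope.

(* [zmod] proves equalities that hold in every abelian group, treating the
   subterms other than sums, opposites and zeros as atoms. *)
Inductive zexpr := ZVar of nat | ZZero | ZAdd of zexpr & zexpr | ZOpp of zexpr.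

Fixpoint zeval (V : zmodType) (l : seq V) (e : zexpr) : V :=
  match e with
  | ZVar n => nth 0 l n
  | ZZero => 0
  | ZAdd a b => zeval l a + zeval l b
  | ZOpp a => - zeval l a
  end.

Fixpoint zcoef (e : zexpr) (n : nat) : int :=
  match e with
  | ZVar m => (m == n)%:Z
  | ZZero => 0
  | ZAdd a b => zcoef a n + zcoef b n
  | ZOpp a => - zcoef a n
  end.

Lemma zevalE (V : zmodType) (l : seq V) e :
  zeval l e = \sum_(i < size l) nth 0 l i *~ zcoef e i.
Proof.
elim: e => [n| |a IHa b IHb|a IHa] /=.
- have [nl|ln] := ltnP n (size l).
    rewrite (bigD1 (Ordinal nl))//= eqxx mulr1z big1 ?addr0// => i /eqP ni.
    by case: eqP => [e|]; [case: ni; apply/val_inj|rewrite mulr0z].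
  rewrite nth_default// big1// => i _; case: eqP => [e|]; last by rewrite mulr0z.
  by move: (ltn_ord i); rewrite -e ltnNge ln.
- by rewrite big1// => i _; rewrite mulr0z.
- by rewrite IHa IHb -big_split; apply: eq_bigr => i _; rewrite mulrzDr.
- by rewrite IHa -sumrN; apply: eq_bigr => i _; rewrite mulrNz.
Qed.

(** By [zevalE] the value depends only on the integer coefficients of the atoms. Their comparison is
    a boolean that evaluates, so [zmod] can pass [isT] as its proof. *)
Lemma zeval_eq (V : zmodType) (l : seq V) a b :
  all (fun i => zcoef a i == zcoef b i) (iota 0 (size l)) -> zeval l a = zeval l b.
Proof.
move=> /allP h; rewrite !zevalE; apply: eq_bigr => i _.
by rewrite (eqP (h i _))// mem_iota ltn_ord.
Qed.

Ltac zindex x l :=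
  lazymatch l with
  | x :: _ => constr:(O)
  | _ :: ?l' => let n := zindex x l' in constr:(S n)
  end.
Ltac zmem x l :=
  match l with
  | x :: _ => constr:(true)
  | _ :: ?l' => zmem x l'
  | nil => constr:(false)
  end.
Ltac zatoms t l :=
  lazymatch t with
  | @GRing.add _ ?a ?b => let l1 := zatoms a l in zatoms b l1
  | @GRing.opp _ ?a => zatoms a l
  | @GRing.zero _ => l
  | _ => let m := zmem t l in
         lazymatch m with true => l | false => constr:(t :: l) end
  end.
Ltac zquote t l :=
  lazymatch t with
  | @GRing.add _ ?a ?b =>
      let a' := zquote a l in let b' := zquote b l in constr:(ZAdd a' b')
  | @GRing.opp _ ?a => let a' := zquote a l in constr:(ZOpp a')
  | @GRing.zero _ => constr:(ZZero)
  | _ => let n := zindex t l in constr:(ZVar n)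
  end.
Ltac zmod :=
  lazymatch goal with
  | |- @eq ?V ?a ?b =>
    let l0 := zatoms a (@nil V) in
    let l := zatoms b l0 in
    let a' := zquote a l in
    let b' := zquote b l in
    exact (@zeval_eq _ l a' b' isT)
  end.

(** * Vector lattices *)

Section VectorLatticeFacts.
Context {R : realType} {E : banachLatticeType R}.
Implicit Types (x y z a b c u v : E) (k : R).

(** Reduces an inequality to a known one with the same difference of sides; the remaining identity
    goes to [zmod]. *)
Lemma vle_eqB x y x' y' : x' <=v y' -> y' - x' = y - x -> x <=v y.
Proof. by move=> /vle_sub0 h e; apply/vle_sub0; rewrite -e. Qed.

Lemma vle_inf x y z : z <=v x -> z <=v y -> z <=v vinf x y.
Proof.
by move=> zx zy; rewrite -[z]opprK; apply: vleN; apply: vsup_le; apply: vleN.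
Qed.

Lemma vinfC x y : vinf x y = vinf y x.
Proof. by rewrite /vinf vsupC. Qed.

Lemma vleZl k x : 0 <= k -> 0 <=v x -> 0 <=v k *: x.
Proof. by move=> k0 /(vleZ _ _ _ k0); rewrite scaler0. Qed.

Lemma vaddr_ge0 x y : 0 <=v x -> 0 <=v y -> 0 <=v x + y.
Proof. by move=> x0 y0; rewrite -[0]addr0; apply: vleD. Qed.

Lemma vsumr_ge0 (I : Type) (r : seq I) (P : pred I) (f : I -> E) :
  (forall i, P i -> 0 <=v f i) -> 0 <=v \sum_(i <- r | P i) f i.
Proof.
move=> f0; apply: (big_ind (fun x : E => 0 <=v x)) => //; first exact: vle_refl.
exact: vaddr_ge0.
Qed.

Lemma vle_addl x y : 0 <=v y -> x <=v x + y.
Proof. by move=> y0; apply: (vle_eqB y0); zmod. Qed.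

Lemma vle_addr x y : 0 <=v y -> x <=v y + x.
Proof. by move=> y0; apply: (vle_eqB y0); zmod. Qed.

Lemma vsupD2r z x y : vsup (x + z) (y + z) = vsup x y + z.
Proof.
apply: vle_anti.
  by apply: vsup_le; apply: vleD2r; [exact: vle_supl|exact: vle_supr].
suff h : vsup x y <=v vsup (x + z) (y + z) - z by apply: (vle_eqB h); zmod.
apply: vsup_le; [apply: (vle_eqB (vle_supl (x + z) (y + z)))|
  apply: (vle_eqB (vle_supr (x + z) (y + z)))]; zmod.
Qed.

Lemma vinfD2r z x y : vinf (x + z) (y + z) = vinf x y + z.
Proof. by rewrite /vinf !opprD vsupD2r opprD opprK. Qed.

Lemma vsup_infD x y : vsup x y + vinf x y = x + y.
Proof.
have := vsupD2r (- x - y) x y; rewrite /vinf.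
have -> : x + (- x - y) = - y by zmod.
have -> : y + (- x - y) = - x by zmod.
by rewrite vsupC => ->; zmod.
Qed.

Lemma vsupZ k x y : 0 <= k -> vsup (k *: x) (k *: y) = k *: vsup x y.
Proof.
rewrite le_eqVlt => /predU1P[<-|k0].
  by rewrite !scale0r; apply: vle_anti; [apply: vsup_le; exact: vle_refl|exact: vle_supl].
have kn : k != 0 by rewrite gt_eqF.
apply: vle_anti.
  by apply: vsup_le; apply: vleZ (ltW k0) _; [exact: vle_supl|exact: vle_supr].
have k1 : 0 <= k^-1 by rewrite invr_ge0 ltW.
have := vleZ k _ _ (ltW k0) (_ : vsup x y <=v k^-1 *: vsup (k *: x) (k *: y)).
rewrite scalerA divff// scale1r; apply.
apply: vsup_le; rewrite -[X in X <=v _]scale1r -(mulVf kn) -scalerA;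
  by apply: vleZ => //; [exact: vle_supl || exact: vle_supr].
Qed.

Lemma vinfZ k x y : 0 <= k -> vinf (k *: x) (k *: y) = k *: vinf x y.
Proof. by move=> k0; rewrite /vinf scalerN -vsupZ// !scalerN. Qed.

Lemma vinf_le x y x' y' : x <=v x' -> y <=v y' -> vinf x y <=v vinf x' y'.
Proof.
move=> xx yy; apply: vle_inf.
  by apply: vle_trans xx; exact: vle_infl.
by apply: vle_trans yy; exact: vle_infr.
Qed.

Definition vpos x := vsup x 0.

Lemma vpos_ge0 x : 0 <=v vpos x. Proof. exact: vle_supr. Qed.

Lemma vle_pos x : x <=v vpos x. Proof. exact: vle_supl. Qed.

Lemma vpos_le x y : x <=v y -> 0 <=v y -> vpos x <=v y. Proof. exact: vsup_le. Qed.

Lemma ge0_vpos x : 0 <=v x -> vpos x = x.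
Proof.
by move=> x0; apply: vle_anti; [apply: vpos_le => //; exact: vle_refl|exact: vle_pos].
Qed.

Lemma vposBN x : vpos x - vpos (- x) = x.
Proof.
have := vsupD2r (- x) x 0; rewrite subrr add0r vsupC /vpos => ->.
by rewrite vsupC; zmod.
Qed.

Lemma vpos_infN x : vinf (vpos x) (vpos (- x)) = 0.
Proof.
have := vinfD2r (- vpos (- x)) (vpos x) (vpos (- x)).
rewrite vposBN subrr /vinf oppr0 -/(vpos (- x)) => h.
by rewrite -[LHS](addrK (- vpos (- x))) -h; zmod.
Qed.

Lemma vabsE x : vabs x = vpos x + vpos (- x).
Proof.
rewrite /vabs -(vsupD2r (vpos (- x)) x 0) add0r.
have -> : x + vpos (- x) = vpos x by rewrite -{1}[x]vposBN subrK.
apply: vle_anti.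
  apply: vsup_le.
    by apply: vle_trans (vle_supl _ _); exact: vle_pos.
  by apply: vle_trans (vle_supr _ _); exact: vle_pos.
have a0 : 0 <=v vabs x by exact: vabs_ge0.
by apply: vsup_le; apply: vpos_le => //; [exact: vle_abs|exact: vleN_abs].
Qed.

Lemma vposZ k x : 0 <= k -> vpos (k *: x) = k *: vpos x.
Proof. by move=> k0; rewrite /vpos -vsupZ// scaler0. Qed.

Lemma norm_le_ge0 x y : 0 <=v x -> x <=v y -> `|x| <= `|y|.
Proof.
move=> x0 xy; have y0 := vle_trans _ _ _ x0 xy.
by apply: vnorm_mono; rewrite -/(vabs x) -/(vabs y) !ge0_vabs.
Qed.

Lemma norm_le_abs x y : x <=v y -> - x <=v y -> `|x| <= `|y|.
Proof.
move=> xy nxy; rewrite -norm_vabs; apply: norm_le_ge0; first exact: vabs_ge0.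
exact: vabs_le.
Qed.

Lemma norm_vpos_le x : `|vpos x| <= `|x|.
Proof.
rewrite -[leRHS]norm_vabs; apply: norm_le_ge0; first exact: vpos_ge0.
by apply: vpos_le; [exact: vle_abs|exact: vabs_ge0].
Qed.

Lemma norm_vabsB x y : `|vabs x - vabs y| <= `|x - y|.
Proof.
have h a b : vabs a - vabs b <=v vabs (a - b).
  suff h : vabs a <=v vabs (a - b) + vabs b by apply: (vle_eqB h); zmod.
  apply: vabs_le.
    by apply: (vle_eqB (vleD (vle_abs (a - b)) (vle_abs b))); zmod.
  by apply: (vle_eqB (vleD (vleN_abs (a - b)) (vleN_abs b))); zmod.
rewrite -[leRHS]norm_vabs; apply: norm_le_abs; first exact: h.
by rewrite opprB -[vabs (x - y)]vabsN opprB; exact: h.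
Qed.

(** The positive cone is closed: for positive [y], [- x] lies below the modulus of [x - y], so the
    norm of the negative part of [x] is at most that of [x - y]. *)
Lemma vge0_approx x :
  (forall e : R, 0 < e -> exists2 y, 0 <=v y & `|x - y| < e) -> 0 <=v x.
Proof.
move=> h; suff -> : x = vpos x by exact: vpos_ge0.
rewrite -[LHS]vposBN; suff -> : vpos (- x) = 0 by rewrite subr0.
apply/eqP; rewrite -normr_eq0 eq_le normr_ge0 andbT.
apply/ler_addgt0Pr => e e0; rewrite add0r; have [y y0 /ltW xy] := h e e0.
apply: le_trans xy; rewrite -[leRHS]norm_vabs; apply: norm_le_ge0.
  exact: vpos_ge0.
apply: vpos_le; last exact: vabs_ge0.
apply: vle_trans (vleN_abs _); apply: (vle_eqB y0); zmod.
Qed.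

Definition vort x y := vinf x y = 0.

Lemma vortC x y : vort x y -> vort y x.
Proof. by rewrite /vort vinfC. Qed.

Lemma vort_le x y z : vort x y -> z <=v x -> z <=v y -> z <=v 0.
Proof. by move=> <-; exact: vle_inf. Qed.

Lemma vort_sub a b x y : vort x y -> 0 <=v a -> a <=v x -> 0 <=v b -> b <=v y ->
  vort a b.
Proof.
move=> xy a0 ax b0 bx; apply: vle_anti; last exact: vle_inf.
by rewrite -xy; exact: vinf_le.
Qed.

Lemma vortP a b : 0 <=v a -> 0 <=v b ->
  (forall c, 0 <=v c -> c <=v a -> c <=v b -> c <=v 0) -> vort a b.
Proof.
move=> a0 b0 h; apply: vle_anti; last exact: vle_inf.
by apply: h; [exact: vle_inf|exact: vle_infl|exact: vle_infr].
Qed.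

Lemma vort_disjoint x y : 0 <=v x -> 0 <=v y -> Defs.disjoint x y <-> vort x y.
Proof. by move=> x0 y0; rewrite /Defs.disjoint !ge0_vabs. Qed.

(** Riesz decomposition. The first summand is [vinf a b]; the rest equals [vsup a b - b], and
    [b + c] dominates that supremum. *)
Lemma vriesz a b c : 0 <=v a -> 0 <=v b -> 0 <=v c -> a <=v b + c ->
  exists a1 a2, [/\ a = a1 + a2, 0 <=v a1, a1 <=v b, 0 <=v a2 & a2 <=v c].
Proof.
move=> a0 b0 c0 abc; exists (vinf a b), (a - vinf a b); split.
- by zmod.
- exact: vle_inf.
- exact: vle_infr.
- by apply/vle_sub0; exact: vle_infl.
- have -> : a - vinf a b = vsup a b - b.
    by have := vsup_infD a b => /(congr1 (fun z => z - b - vinf a b)) h;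
       apply/esym; apply: etrans (etrans h _); zmod.
  suff h : vsup a b <=v b + c by apply: (vle_eqB h); zmod.
  by apply: vsup_le => //; exact: vle_addl.
Qed.

Lemma vort_add x y z : 0 <=v x -> 0 <=v y -> 0 <=v z -> vort x y -> vort x z ->
  vort x (y + z).
Proof.
move=> x0 y0 z0 xy xz; apply: vortP => //; first exact: vaddr_ge0.
move=> c c0 cx cyz; have [a [b [ce a0 ay b0 bz]]] := vriesz c0 y0 z0 cyz.
rewrite ce in cx *.
have ax : a <=v x by apply: vle_trans cx; exact: vle_addl.
have bx : b <=v x by apply: vle_trans cx; exact: vle_addr.
by rewrite -[0]addr0; apply: vleD; [exact: vort_le xy _ _|exact: vort_le xz _ _].
Qed.

Lemma vort0 x : 0 <=v x -> vort x 0.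
Proof. by move=> x0; apply: vortP => //; exact: vle_refl. Qed.

Lemma vort_sum (I : Type) (r : seq I) (f : I -> E) x : 0 <=v x ->
  (forall i, 0 <=v f i) -> (forall i, vort x (f i)) -> vort x (\sum_(i <- r) f i).
Proof.
move=> x0 f0 xf; elim: r => [|i r IH]; first by rewrite big_nil; exact: vort0.
by rewrite big_cons; apply: vort_add => //; exact: vsumr_ge0.
Qed.

Lemma vleZr k x : 0 <=v x -> 0 <= k -> x <=v (1 + k) *: x.
Proof. by move=> x0 k0; rewrite scalerDl scale1r; apply: vle_addl; exact: vleZl. Qed.

(** Multiplying both elements by [1 + k] keeps their infimum 0, and the products dominate [x] and
    [k *: y]. *)
Lemma vortZ k x y : 0 <= k -> 0 <=v x -> 0 <=v y -> vort x y -> vort x (k *: y).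
Proof.
move=> k0 x0 y0 xy.
have k1 : 0 <= 1 + k by rewrite addr_ge0.
have h : vort ((1 + k) *: x) ((1 + k) *: y) by rewrite /vort vinfZ// xy scaler0.
apply: (vort_sub h) => //; [exact: vleZr|exact: vleZl|].
by rewrite addrC scalerDl scale1r; exact: vle_addl.
Qed.

End VectorLatticeFacts.

(** * Cutting along bands under a lower 2-estimate *)

Section Truncations.
Context {R : realType} {E : banachLatticeType R}.
Implicit Types (x y z a b c u v h : E).

Lemma cauchy_seq_limit (a : nat -> E) :
  (forall e : R, 0 < e -> exists N, forall n, (N <= n)%N -> `|a n - a N| < e) ->
  exists l, forall e : R, 0 < e -> exists N, forall n, (N <= n)%N -> `|a n - l| < e.
Proof.
move=> ca; have : cvg (a @ \oo).
  apply: cauchy_cvg; apply/cauchyP => e /ca[N aN]; exists (a N).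
  by exists N => // n /= Nn; rewrite -ball_normE /= distrC; exact: aN.
move=> /cvg_ex[l al]; exists l => e e0.
have /cvgrPdist_lt/(_ _ e0)[N _ aN] := al.
by exists N => n Nn; rewrite distrC; exact: aN.
Qed.

(** For positive [h] and [x] the supremum over [n], when it exists, is the component of [x] in the
    band generated by [h]. *)
Definition vtrunc h x (n : nat) := vinf x (n%:R *: h).

Lemma vtrunc_le h x n : vtrunc h x n <=v x. Proof. exact: vle_infl. Qed.

Lemma vtrunc_ge0 h x n : 0 <=v h -> 0 <=v x -> 0 <=v vtrunc h x n.
Proof. by move=> h0 x0; apply: vle_inf => //; apply: vleZl. Qed.

Lemma vleZn h (k k' : R) : 0 <=v h -> k <= k' -> k *: h <=v k' *: h.
Proof.
move=> h0 kk; apply/vle_sub0; rewrite -scalerBl; apply: vleZl => //.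
by rewrite subr_ge0.
Qed.

Lemma vtrunc_homo h x m n : 0 <=v h -> (m <= n)%N -> vtrunc h x m <=v vtrunc h x n.
Proof.
move=> h0 mn; apply: vinf_le; first exact: vle_refl.
by apply: vleZn => //; rewrite ler_nat.
Qed.

(** The whole remainder [x - vtrunc h x m] equals the positive part of [x - m%:R *: h]. This makes
    late increments disjoint from suitably reduced early ones. *)
Lemma vtruncB_pos h x m n : vtrunc h x n - vtrunc h x m <=v vpos (x - m%:R *: h).
Proof.
apply: (@vle_trans _ _ (x - vtrunc h x m)).
  by apply: vleD2r; exact: vtrunc_le.
have := vsup_infD x (m%:R *: h); rewrite -/(vtrunc h x m) => e.
have -> : x - vtrunc h x m = vsup x (m%:R *: h) - m%:R *: h.
  move/(congr1 (fun z => z - vtrunc h x m - m%:R *: h)): e => e.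
  by apply: etrans (etrans (esym e) _); zmod.
by rewrite -vsupD2r subrr; exact: vle_refl.
Qed.

Variable M : R.
Hypothesis M0 : 0 < M.
Hypothesis hE : lower_2_estimate E M.

Lemma lower2_sum n (x : 'I_n -> E) :
  (forall i, 0 <=v x i) -> (forall i j, i != j -> vort (x i) (x j)) ->
  \sum_i `|x i| ^+ 2 <= (M * `|\sum_i x i|) ^+ 2.
Proof.
move=> x0 xx; have S0 : 0 <= \sum_i `|x i| ^+ 2 by apply: sumr_ge0.
have := hE (fun i j ij => (vort_disjoint (x0 i) (x0 j)).2 (xx i j ij)).
rewrite mulrC ler_pdivrMr// mulrC => h.
by rewrite -(sqr_sqrtr S0) ler_sqr ?nnegrE ?sqrtr_ge0// mulr_ge0// ltW.
Qed.

(** Otherwise infinitely many increments [d k] have norm at least [e]. Removing the small multiple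
    [L.+1%:R^-1 *: x] from each leaves disjoint elements [d' k] of norm at least [e / 2] whose
    partial sums stay below [x], and the lower 2-estimate bounds their number. *)
Lemma vtrunc_cauchy h x : 0 <=v h -> 0 <=v x -> forall e : R, 0 < e ->
  exists N, forall n, (N <= n)%N -> `|vtrunc h x n - vtrunc h x N| < e.
Proof.
move=> h0 x0 e e0; apply: contrapT => /forallNP H.
have /choice[nu nuP] N : exists n, (N <= n)%N /\ e <= `|vtrunc h x n - vtrunc h x N|.
  have /existsNP[n /not_implyP[Nn /negP]] := H N; rewrite -leNgt => en.
  by exists n.
have [L Le] : exists L : nat, L.+1%:R^-1 * `|x| <= e / 2.
  have x2 : 0 <= `|x| / (e / 2) by rewrite divr_ge0// divr_ge0// ltW.
  exists (Num.bound (`|x| / (e / 2))); rewrite mulrC ler_pdivrMr//.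
  rewrite mulrC -ler_pdivrMr ?divr_gt0//.
  by rewrite (le_trans (ltW (archi_boundP x2)))// ler_nat.
(* The factor [L.+1] gives [nu (NN i) <= NN j / L.+1] for [i < j], hence [d i] lies below
   [NN j / L.+1] times [h]. *)
pose fix NN k := if k is k'.+1 then (L.+1 * nu (NN k'))%N else 0%N.
have NNS k : (nu (NN k) <= NN k.+1)%N by rewrite /= leq_pmull.
have NNle k : (NN k <= NN k.+1)%N by apply: leq_trans (NNS k); exact: (nuP _).1.
have NNhomo i j : (i <= j)%N -> (NN i <= NN j)%N.
  by move=> ij; apply: (homo_leq (@leqnn) leq_trans NNle).
pose d k := vtrunc h x (nu (NN k)) - vtrunc h x (NN k).
have d0 k : 0 <=v d k by apply/vle_sub0; apply: vtrunc_homo => //; exact: (nuP _).1.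
pose d' k := vpos (d k - L.+1%:R^-1 *: x).
have d'0 k : 0 <=v d' k by exact: vpos_ge0.
have d'd k : d' k <=v d k.
  apply: vpos_le => //; apply: (@vle_eqB _ _ _ _ 0 (L.+1%:R^-1 *: x)); last by zmod.
  by apply: vleZl => //; rewrite invr_ge0.
have d'e k : e / 2 <= `|d' k|.
  have : `|d k| <= `|d' k| + L.+1%:R^-1 * `|x|.
    have -> : L.+1%:R^-1 * `|x| = `|L.+1%:R^-1 *: x|.
      by rewrite normrZ ger0_norm// invr_ge0.
    apply: le_trans (ler_normD _ _); apply: norm_le_ge0 => //.
    by apply: (vle_eqB (vle_pos (d k - L.+1%:R^-1 *: x))); rewrite /d'; zmod.
  have := (nuP (NN k)).2; rewrite -/(d k) => ed h1.
  have := le_trans ed (le_trans h1 (lerD (lexx _) Le)).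
  by rewrite -lerBlDr [X in X - _]splitr addrK.
(* With [z] as below, [d' i] lies below a multiple of the negative part of [z], and [d' j] below its
   positive part. *)
have ort i j : (i < j)%N -> vort (d' i) (d' j).
  move=> ij; pose z := x - (NN j)%:R *: h.
  have L0 : 0 <= (L.+1%:R^-1 : R) by rewrite invr_ge0.
  apply: (@vort_sub _ _ _ _ (L.+1%:R^-1 *: vpos (- z)) (vpos z)) => //.
  - apply: vortC; apply: vortZ => //; [exact: vpos_ge0..|exact: vpos_infN].
  - rewrite -vposZ//; apply: vpos_le; last exact: vpos_ge0.
    apply: (vle_trans _ _ _ _ (vle_pos _)).
    suff h1 : d i <=v (nu (NN i))%:R *: h.
      have h2 : (nu (NN i))%:R *: h <=v (L.+1%:R^-1 * (NN j)%:R) *: h.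
        apply: vleZn => //; rewrite mulrC ler_pdivlMr// mulrC -natrM ler_nat.
        exact: NNhomo ij.
      apply: (vle_eqB (vle_trans _ _ _ h1 h2)).
      have -> : - z = (NN j)%:R *: h - x by rewrite opprB.
      rewrite scalerBr scalerA; set A := (_ * _) *: h; set B := _ *: x; zmod.
    apply: (@vle_trans _ _ (vtrunc h x (nu (NN i)))); last exact: vle_infr.
    apply: (vle_eqB (vtrunc_ge0 (NN i) h0 x0)); rewrite /d; zmod.
  - apply: (vle_trans _ _ _ (d'd j)); exact: vtruncB_pos.
have ortd i j : i != j -> vort (d' i) (d' j).
  by rewrite neq_ltn => /orP[/ort//|/ort/vortC].
(* The intervals from [NN k] to [nu (NN k)] do not overlap, so the sum telescopes up to nonnegative
   gaps. *)
have sumd K : \sum_(k < K) d k <=v vtrunc h x (NN K).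
  elim: K => [|K IH]; first by rewrite big_ord0; exact: vtrunc_ge0.
  rewrite big_ord_recr [X in X <=v _]/=; apply: (vle_trans _ _ _ (vleD2r (d K) _ _ IH)).
  apply: (vle_eqB (vtrunc_homo x h0 (NNS K))); rewrite /d; zmod.
have sumx K : \sum_(k < K) d' k <=v x.
  apply: (vle_trans _ _ _ _ (vtrunc_le h x (NN K))).
  apply: (vle_trans _ _ _ _ (sumd K)).
  by elim/big_ind2 : _ => // *; [exact: vle_refl|exact: vleD].
have key K : K%:R * (e / 2) ^+ 2 <= (M * `|x|) ^+ 2.
  apply: (@le_trans _ _ (\sum_(k < K) `|d' k| ^+ 2)).
    rewrite -[K in leLHS]card_ord mulr_natl -sumr_const; apply: ler_sum => k _.
    by rewrite ler_sqr ?nnegrE// divr_ge0// ltW.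
  apply: (le_trans (lower2_sum _ _)) => //.
    by move=> i j ij; apply: ortd.
  rewrite ler_sqr ?nnegrE ?mulr_ge0 ?(ltW M0)// ler_pM2l//.
  by apply: norm_le_ge0; [exact: vsumr_ge0|exact: sumx].
have e2 : 0 < (e / 2) ^+ 2 by rewrite exprn_gt0// divr_gt0.
have X0 : 0 <= (M * `|x|) ^+ 2 / (e / 2) ^+ 2 by rewrite divr_ge0 ?sqr_ge0.
have := archi_boundP X0; set K := Num.bound _ => /lt_geF.
by rewrite ler_pdivlMr// key.
Qed.

(** The norm limit of the truncations is their supremum, because they increase and the cone is
    closed. *)
Lemma vtrunc_sup h x : 0 <=v h -> 0 <=v x ->
  exists u, (forall n, vtrunc h x n <=v u) /\
            (forall c, (forall n, vtrunc h x n <=v c) -> u <=v c).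
Proof.
move=> h0 x0; have [u au] := cauchy_seq_limit (vtrunc_cauchy h0 x0); exists u.
split=> [n|c ac]; apply/vle_sub0; apply: vge0_approx => e /au[N aN].
  exists (vtrunc h x (maxn n N) - vtrunc h x n).
    by apply/vle_sub0; apply: vtrunc_homo => //; exact: leq_maxl.
  have := aN _ (leq_maxr n N); rewrite distrC; congr (`|_| < _); zmod.
exists (c - vtrunc h x N); first exact/vle_sub0/ac.
have := aN _ (leqnn N); congr (`|_| < _); zmod.
Qed.

(** Here [u i] is the supremum of the truncations of [w i]: its component in the band of [h], while
    [v i] is the component in the disjoint complement. *)
Lemma band_split (I : Type) (w : I -> E) h : 0 <=v h -> (forall i, 0 <=v w i) ->
  exists u v : I -> E, [/\ forall i, w i = u i + v i, forall i, 0 <=v u i,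
    forall i, 0 <=v v i & forall i, vort h (v i)] /\
    forall i b, 0 <=v b -> vort h b -> vort (u i) b.
Proof.
move=> h0 w0.
have /choice[u /all_and2[au uP]] i := vtrunc_sup h0 (w0 i).
have u0 i : 0 <=v u i by apply: vle_trans (au i 0%N); exact: vtrunc_ge0.
have uw i : u i <=v w i by apply: uP => n; exact: vtrunc_le.
have ortu i b : 0 <=v b -> vort h b -> vort (u i) b.
  move=> b0 hb; apply: vortP => // c c0 cu cb.
  suff h1 : u i <=v u i - c by apply: (vle_eqB h1); zmod.
  apply: uP => n; have tn := vtrunc_ge0 n h0 (w0 i).
  have tc : vort (vtrunc h (w i) n) c.
    apply: (@vort_sub _ _ _ _ (n%:R *: h) b) => //; last exact: vle_infr.
    by apply/vortC/vortZ => //; exact/vortC.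
  (* The truncation and [c] are disjoint, so their sum is their supremum. *)
  suff h1 : vsup (vtrunc h (w i) n) c <=v u i.
    apply: (vle_eqB h1); rewrite -[vsup _ _](addrK (vinf (vtrunc h (w i) n) c)).
    by rewrite vsup_infD tc; zmod.
  by apply: vsup_le.
exists u, (fun i => w i - u i); split=> //; split=> // i.
- by zmod.
- exact/vle_sub0.
have v0 : 0 <=v w i - u i by exact/vle_sub0.
apply: vortP => // c c0 ch cv.
suff h1 : u i <=v u i - c by apply: (vle_eqB h1); zmod.
(* As [c] lies below both [h] and [w i - u i], adding it to the truncation at level [n] gives an
   element below the one at level [n.+1]. *)
apply: uP => n; suff h1 : vtrunc h (w i) n + c <=v u i by apply: (vle_eqB h1); zmod.
apply: vle_trans (au i n.+1); apply: vle_inf.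
  by apply: (vle_eqB (vleD (au i n) cv)); zmod.
rewrite -natr1 scalerDl scale1r; apply: vleD => //; exact: vle_infr.
Qed.

(* Cut along the band of [(w i - k e)^+], where [e] is the sum of the family. *)
Lemma family_split (I : finType) (w : I -> E) i (k : R) :
  (forall j, 0 <=v w j) -> 0 <= k ->
  exists u v : I -> E,
  [/\ forall j, w j = u j + v j, forall j, 0 <=v u j, forall j, 0 <=v v j,
      forall j l, vort (u j) (v l) &
      k *: (\sum_j u j) <=v u i /\ v i <=v k *: (\sum_j v j)].
Proof.
move=> w0 k0; pose e := \sum_j w j; pose z := w i - k *: e.
have [u [v [[wE u0 v0 hv] ortu]]] := band_split (vpos_ge0 z) w0.
have eE : e = \sum_j u j + \sum_j v j by rewrite /e -big_split; apply: eq_bigr.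
set eu := \sum_j u j in eE *; set ev := \sum_j v j in eE *.
have eu0 : 0 <=v eu by exact: vsumr_ge0.
have ev0 : 0 <=v ev by exact: vsumr_ge0.
have uv j l : vort (u j) (v l) by apply: ortu.
have zE : u i + v i - k *: eu - k *: ev = vpos z - vpos (- z).
  by rewrite vposBN /z eE scalerDr wE; zmod.
have ueu j : vort (v j) eu by apply: vort_sum => // l; exact/vortC.
exists u, v; rewrite -/eu -/ev; split=> //; split.
  suff h : k *: eu - u i <=v 0 by apply: (vle_eqB h); zmod.
  (* By [zE], [k *: eu - u i] lies below two disjoint elements, hence below 0 by [vort_le]. The
     bound for [v i] is obtained in the same way. *)
  have nz : vort (k *: eu) (v i + vpos (- z)).
    apply/vortC/vortZ => //; first by apply: vaddr_ge0 => //; exact: vpos_ge0.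
    apply/vortC/vort_add => //; [exact: vpos_ge0|exact/vortC|].
    apply/vortC/vort_sum => //; first exact: vpos_ge0.
    by move=> l; apply/vortC/ortu; [exact: vpos_ge0|exact: vpos_infN].
  apply: (vort_le nz); first by apply: (vle_eqB (u0 i)); zmod.
  apply: (vle_eqB (vaddr_ge0 (vpos_ge0 z) (vleZl k0 ev0))).
  have -> : vpos (- z) = vpos z - (u i + v i - k *: eu - k *: ev) by rewrite zE; zmod.
  by zmod.
suff h : v i - k *: ev <=v 0 by apply: (vle_eqB h); zmod.
have nz : vort (v i) (vpos z + k *: eu).
  apply: vort_add => //; [exact: vpos_ge0|exact: vleZl|exact/vortC/hv|exact: vortZ].
apply: (vort_le nz); first by apply: (vle_eqB (vleZl k0 ev0)); zmod.
apply: (vle_eqB (vaddr_ge0 (vpos_ge0 (- z)) (u0 i))).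
have -> : vpos z = vpos (- z) + (u i + v i - k *: eu - k *: ev) by rewrite zE; zmod.
by zmod.
Qed.

(** Near proportionality of the whole family to one element, its sum. *)
Definition narrow (I : finType) (d : I -> R) (w : I -> E) :=
  forall i, exists2 k : R, 0 <= k &
    k *: (\sum_j w j) <=v w i /\ w i <=v (k + d i) *: (\sum_j w j).

(** The terms that come from [v] are disjoint from those that come from [u], so [vort_le] removes
    them from both inequalities. *)
Lemma family_le_split (I : finType) (w u v : I -> E) i (k k' : R) :
  (forall j, w j = u j + v j) -> (forall j, 0 <=v u j) -> (forall j, 0 <=v v j) ->
  (forall j l, vort (u j) (v l)) -> 0 <= k -> 0 <= k' ->
  k *: (\sum_j w j) <=v w i -> w i <=v k' *: (\sum_j w j) ->
  k *: (\sum_j u j) <=v u i /\ u i <=v k' *: (\sum_j u j).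
Proof.
move=> wE u0 v0 uv k0 k'0.
have -> : \sum_j w j = \sum_j u j + \sum_j v j by rewrite -big_split; apply: eq_bigr.
rewrite !scalerDr wE.
set eu := \sum_j u j; set ev := \sum_j v j => h h'.
have eu0 : 0 <=v eu by exact: vsumr_ge0.
have ev0 : 0 <=v ev by exact: vsumr_ge0.
split.
  suff s : k *: eu - u i <=v 0 by apply: (vle_eqB s); zmod.
  have nz : vort (k *: eu) (v i).
    by apply/vortC/vortZ/vort_sum => // l; exact/vortC.
  apply: (vort_le nz); first by apply: (vle_eqB (u0 i)); zmod.
  apply: (vle_eqB (vleD (vleZl k0 ev0) h)); zmod.
suff s : u i - k' *: eu <=v 0 by apply: (vle_eqB s); zmod.
have nz : vort (u i) (k' *: ev) by apply/vortZ/vort_sum.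
apply: (vort_le nz); first by apply: (vle_eqB (vleZl k'0 eu0)); zmod.
apply: (vle_eqB (vleD (v0 i) h')); zmod.
Qed.

(** Bisection: each cut by [family_split] halves the width allowed for one index. With widths
    [d * 2 ^+ r i] the induction runs on the sum of the exponents [r i]. *)
Lemma disjoint_join_ind (I : finType) (P : (I -> E) -> Prop) (d : R) : 0 < d ->
  (forall w u v : I -> E, (forall j, w j = u j + v j) -> (forall j, 0 <=v u j) ->
    (forall j, 0 <=v v j) -> (forall j l, vort (u j) (v l)) -> P u -> P v -> P w) ->
  (forall w, (forall j, 0 <=v w j) -> narrow (fun=> d) w -> P w) ->
  forall w, (forall j, 0 <=v w j) -> P w.
Proof.
move=> d0 join base.
have step s (r : I -> nat) w : (\sum_i r i <= s)%N ->
    (forall j, 0 <=v w j) -> narrow (fun i => d * 2 ^+ r i) w -> P w.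
  elim: s r w => [|s IH] r w.
    rewrite leqn0 sum_nat_eq0 => /forallP r0 w0 nw; apply: base => // i.
    by have := nw i; rewrite (eqP (implyP (r0 i) isT)) expr0 mulr1.
  move=> rs w0 nw; have [/forallP r0|/forallPn[i ri]] := boolP [forall i, r i == 0%N].
    apply: base => // i.
    by have := nw i; rewrite (eqP (r0 i)) expr0 mulr1.
  pose r' j := if j == i then (r i).-1 else r j.
  have r's : (\sum_i r' i <= s)%N.
    rewrite -ltnS (leq_trans _ rs)// (bigD1 i)//= [in ltnRHS](bigD1 i)//=.
    rewrite {1}/r' eqxx -addSn prednK ?lt0n// leq_add2l.
    by apply: leq_sum => j /negbTE ji; rewrite /r' ji.
  have rE : d * 2 ^+ r i = d * 2 ^+ r' i + d * 2 ^+ r' i.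
    by rewrite /r' eqxx -[in LHS](prednK (_ : 0 < r i)%N) ?lt0n// exprS; lra.
  have dr j : 0 <= d * 2 ^+ r' j by rewrite mulr_ge0 ?ltW// exprn_gt0.
  have dr0 j : 0 <= d * 2 ^+ r j by rewrite mulr_ge0 ?ltW// exprn_gt0.
  have [k k0 [kw wk]] := nw i.
  (* The cut is at the midpoint of the interval for index [i]: on [u] it becomes the new lower
     bound, on [v] the new upper bound. All other bounds are inherited. *)
  have [||u [v [wE u0 v0 uv [ku vk]]]] := @family_split _ w i (k + d * 2 ^+ r' i) => //.
    by rewrite addr_ge0.
  have vu j l : vort (v j) (u l) by exact/vortC.
  have wE' j : w j = v j + u j by rewrite wE addrC.
  apply: (join w u v) => //; apply: (IH r') => // j; have [->|ji] := eqVneq j i.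
  - exists (k + d * 2 ^+ r' i); first by rewrite addr_ge0.
    split=> //; rewrite -addrA -rE.
    by have [] := family_le_split wE u0 v0 uv k0 (addr_ge0 k0 (dr0 i)) kw wk.
  - have [k1 k10 [k1w wk1]] := nw j; exists k1 => //.
    rewrite /r' (negbTE ji).
    exact: family_le_split wE u0 v0 uv k10 (addr_ge0 k10 (dr0 j)) k1w wk1.
  - exists k => //; split=> //.
    by have [] := family_le_split wE' v0 u0 vu k0 (addr_ge0 k0 (dr0 i)) kw wk.
  - have [k1 k10 [k1w wk1]] := nw j; exists k1 => //.
    rewrite /r' (negbTE ji).
    exact: family_le_split wE' v0 u0 vu k10 (addr_ge0 k10 (dr0 j)) k1w wk1.
(* Every [w i] lies between 0 and the sum, so any exponent that makes the width at least 1 can start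
   the induction. *)
move=> w w0; pose r := Num.bound d^-1.
have rd : 1 <= d * 2 ^+ r.
  have d1 : 0 <= d^-1 by rewrite invr_ge0 ltW.
  rewrite mulrC -ler_pdivrMr// div1r (le_trans (ltW (archi_boundP d1)))//.
  by rewrite -natrX ler_nat ltnW// ltn_expl.
apply: (step _ (fun=> r) w (leqnn _)) => // i; exists 0 => //; rewrite scale0r add0r.
split=> //; apply: (@vle_trans _ _ (1 *: \sum_j w j)).
  by rewrite scale1r (bigD1 i)//=; apply: vle_addl; exact: vsumr_ge0.
by apply: vleZn => //; exact: vsumr_ge0.
Qed.
End Truncations.

(** * The bound on the variation *)

Section SquareVariation.
Context {R : realType} {E : banachLatticeType R}.
Implicit Types (x y z a b c u v h : E).
Variable M : R.
Hypothesis M0 : 0 < M.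
Hypothesis hE : lower_2_estimate E M.

Definition sqvar_set x : set R := [set r | exists n (f : 'I_n -> E),
  [/\ forall i, 0 <=v f i, forall i j, i != j -> vort (f i) (f j),
      \sum_i f i = x & r = \sum_i `|f i| ^+ 2]].

(** Replaces the squared norm, which for [M > 1] need not be superadditive on disjoint elements. By
    [sqvar_ge] and [sqvar_le] it differs from it by a factor at most [M ^+ 2]. *)
Definition sqvar x : R := sup (sqvar_set x).

Lemma sqvar_set_ub x : ubound (sqvar_set x) ((M * `|x|) ^+ 2).
Proof. by move=> _ [n [f [f0 ff <- ->]]]; exact: lower2_sum. Qed.

Lemma sqvar_set_norm x : 0 <=v x -> sqvar_set x (`|x| ^+ 2).
Proof.
move=> x0; exists 1%N, (fun=> x); split=> //; last by rewrite big_ord1.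
  by move=> i j; rewrite !ord1 eqxx.
by rewrite big_ord1.
Qed.

Lemma sqvar_has_sup x : 0 <=v x -> has_sup (sqvar_set x).
Proof.
by move=> x0; split; [exists (`|x| ^+ 2); exact: sqvar_set_norm|
  exists ((M * `|x|) ^+ 2); exact: sqvar_set_ub].
Qed.

Lemma sqvar_ge x : 0 <=v x -> `|x| ^+ 2 <= sqvar x.
Proof.
by move=> x0; apply: ub_le_sup; [exact: (sqvar_has_sup x0).2|exact: sqvar_set_norm].
Qed.

Lemma sqvar_ge0 x : 0 <=v x -> 0 <= sqvar x.
Proof. by move=> /sqvar_ge; apply: le_trans; rewrite sqr_ge0. Qed.

Lemma sqvar_le x : 0 <=v x -> sqvar x <= (M * `|x|) ^+ 2.
Proof.
by move=> x0; apply: ge_sup; [exact: (sqvar_has_sup x0).1|exact: sqvar_set_ub].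
Qed.

Lemma vle_sum_term (I : finType) (f : I -> E) i :
  (forall i, 0 <=v f i) -> f i <=v \sum_i f i.
Proof. by move=> f0; rewrite (bigD1 i)//=; apply: vle_addl; exact: vsumr_ge0. Qed.

(** Disjoint decompositions of [u] and of [v] together form one of [u + v]. *)
Lemma sqvarD u v : 0 <=v u -> 0 <=v v -> vort u v ->
  sqvar u + sqvar v <= sqvar (u + v).
Proof.
move=> u0 v0 uv.
have su := sqvar_has_sup u0; have sv := sqvar_has_sup v0.
rewrite -sup_sumE//; apply: ge_sup.
  by exists (`|u| ^+ 2 + `|v| ^+ 2), (`|u| ^+ 2); [exact: sqvar_set_norm|
    exists (`|v| ^+ 2) => //; exact: sqvar_set_norm].
move=> _ [_ [m [f [f0 ff fu ->]]] [_ [n [g [g0 gg gv ->]]] <-]].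
apply: ub_le_sup; first exact: (sqvar_has_sup (vaddr_ge0 u0 v0)).2.
pose h (k : 'I_(m + n)) := match fintype.split k with inl i => f i | inr j => g j end.
have fg i j : vort (f i) (g j).
  by apply: (vort_sub uv) => //; [rewrite -fu|rewrite -gv]; exact: vle_sum_term.
have hl i : h (lshift n i) = f i by rewrite /h -[lshift n i]/(unsplit (inl i)) unsplitK.
have hr i : h (rshift m i) = g i by rewrite /h -[rshift m i]/(unsplit (inr i)) unsplitK.
exists (m + n)%N, h; split.
- by move=> k; rewrite /h; case: fintype.split.
- move=> i j; rewrite -[i]splitK -[j]splitK.
  case: (fintype.split i) => i'; case: (fintype.split j) => j' /=; rewrite ?hl ?hr => ij //.
  + by apply: ff; apply: contraNneq ij => ->.
  + exact/vortC.
  + by apply: gg; apply: contraNneq ij => ->.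
- rewrite big_split_ord/= -fu -gv.
  by congr (_ + _); apply: eq_bigr => i _; rewrite ?hl ?hr.
- rewrite big_split_ord/=.
  by congr (_ + _); apply: eq_bigr => i _; rewrite ?hl ?hr.
Qed.

(** A reversed triangle inequality: multiples of a single [e] have additive norms, and the deviation
    of the [f i] from such multiples is paid for by [d' *: e]. *)
Lemma sum_norm_narrow (K : finType) (f : K -> E) (k : K -> R) e (d d' : R) :
  0 <=v e -> (forall i, 0 <= k i) -> 0 <= d -> #|K|%:R * d <= d' ->
  (forall i, 0 <=v f i) ->
  (forall i, k i *: e <=v f i /\ f i <=v (k i + d) *: e) ->
  \sum_i `|f i| <= `|\sum_i f i + d' *: e|.
Proof.
move=> e0 k0 d0 dd f0 fk.
apply: (@le_trans _ _ (\sum_i (k i + d) * `|e|)).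
  apply: ler_sum => i _; have kd : 0 <= k i + d by rewrite addr_ge0.
  rewrite -[X in X * _]ger0_norm// -normrZ; apply: norm_le_ge0 => //.
  exact: (fk i).2.
have kd : 0 <= \sum_i (k i + d) by apply: sumr_ge0 => i _; rewrite addr_ge0.
rewrite -mulr_suml -[X in X * _]ger0_norm// -normrZ.
apply: norm_le_ge0; first exact: vleZl.
rewrite big_split/= scalerDl; apply: vleD.
  rewrite scaler_suml; elim/big_ind2 : _ => //; first exact: vle_refl.
    by move=> *; exact: vleD.
  by move=> i _; exact: (fk i).1.
by apply: vleZn => //; rewrite sumr_const -mulr_natl.
Qed.

Lemma sqrt_cauchy_schwarz (a b c d : R) : 0 <= a -> 0 <= b -> 0 <= c -> 0 <= d ->
  Num.sqrt a * Num.sqrt b + Num.sqrt c * Num.sqrt d <=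
  Num.sqrt (a + c) * Num.sqrt (b + d).
Proof.
move=> a0 b0 c0 d0; rewrite -[leRHS]sqrtrM ?addr_ge0//.
rewrite -[leLHS]ger0_norm ?addr_ge0 ?mulr_ge0 ?sqrtr_ge0// -sqrtr_sqr.
rewrite ler_sqrt ?mulr_ge0 ?addr_ge0//.
rewrite -{2}(sqr_sqrtr a0) -{2}(sqr_sqrtr b0) -{2}(sqr_sqrtr c0) -{2}(sqr_sqrtr d0).
set A := Num.sqrt a; set B := Num.sqrt b; set C := Num.sqrt c; set D := Num.sqrt d.
rewrite -subr_ge0.
have -> : (A ^+ 2 + C ^+ 2) * (B ^+ 2 + D ^+ 2) - (A * B + C * D) ^+ 2 =
  (A * D - C * B) ^+ 2 by ring.
exact: sqr_ge0.
Qed.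

Variable g : E -> E -> R.
Hypothesis gDl : forall x x' y, 0 <=v x -> 0 <=v x' -> 0 <=v y ->
  g (x + x') y <= g x y + g x' y.
Hypothesis gDr : forall x y y', 0 <=v x -> 0 <=v y -> 0 <=v y' ->
  g x (y + y') <= g x y + g x y'.
Hypothesis g_norm : forall x y, g x y <= `|x| * `|y|.
Hypothesis g_ort : forall x y, 0 <=v x -> 0 <=v y -> vort x y -> g x y = 0.

(** Both families are treated as one family [w] over [I + J], so that they are cut along the same
    bands. The estimate [main] is proved by [disjoint_join_ind]; afterwards [e] tends to 0 and
    [sqvar_le] contributes the factor [M ^+ 2]. *)
Lemma sum_form_le (I J : finType) (x : I -> E) (y : J -> E) :
  (forall i, 0 <=v x i) -> (forall j, 0 <=v y j) ->
  \sum_i \sum_j g (x i) (y j) <= M ^+ 2 * (`|\sum_i x i| * `|\sum_j y j|).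
Proof.
move=> x0 y0.
pose X (w : I + J -> E) := \sum_i w (inl i).
pose Y (w : I + J -> E) := \sum_j w (inr j).
pose Z (w : I + J -> E) := \sum_k w k.
(* The slack [e *: Z w] absorbs the error from narrow families; it is additive in [w], so it
   survives the joining of disjoint pieces. *)
pose A (e : R) w := X w + e *: Z w.
pose B (e : R) w := Y w + e *: Z w.
have X0 w : (forall j, 0 <=v w j) -> 0 <=v X w by move=> w0; exact: vsumr_ge0.
have Y0 w : (forall j, 0 <=v w j) -> 0 <=v Y w by move=> w0; exact: vsumr_ge0.
have Z0 w : (forall j, 0 <=v w j) -> 0 <=v Z w by move=> w0; exact: vsumr_ge0.
have A0 e w : 0 <= e -> (forall j, 0 <=v w j) -> 0 <=v A e w.
  by move=> e0 w0; apply: vaddr_ge0; [exact: X0|exact/vleZl/Z0].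
have B0 e w : 0 <= e -> (forall j, 0 <=v w j) -> 0 <=v B e w.
  by move=> e0 w0; apply: vaddr_ge0; [exact: Y0|exact/vleZl/Z0].
have main (e : R) : 0 < e -> forall w, (forall j, 0 <=v w j) ->
    \sum_i \sum_j g (w (inl i)) (w (inr j)) <=
    Num.sqrt (sqvar (A e w)) * Num.sqrt (sqvar (B e w)).
  (* One error [d] per index of either family then amounts to at most [e]. *)
  move=> e0; pose d := e / (#|{: I + J}|.+1)%:R.
  have d0 : 0 < d by rewrite divr_gt0.
  apply: (disjoint_join_ind M0 hE d0) => [w u v wE u0 v0 uv Pu Pv|w w0 nw].
    have h (f : (I + J -> E) -> E) : (forall z : I + J -> E, (forall j, 0 <=v z j) -> 0 <=v f z) ->
        (forall (z : I + J -> E) c, 0 <=v c -> (forall j, 0 <=v z j) ->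
          (forall j, vort (z j) c) -> vort (f z) c) ->
        f w = f u + f v -> sqvar (f u) + sqvar (f v) <= sqvar (f w).
      move=> f0 fo ->; apply: sqvarD; [exact: f0..|].
      apply: (fo _ _) => // [|j]; first exact: f0.
      by apply/vortC/fo => // l; exact/vortC.
    have wA : A e w = A e u + A e v.
      rewrite /A /X /Z.
      under eq_bigr do rewrite wE.
      under [X in e *: X]eq_bigr do rewrite wE.
      by rewrite !big_split/= scalerDr addrACA.
    have wB : B e w = B e u + B e v.
      rewrite /B /Y /Z.
      under eq_bigr do rewrite wE.
      under [X in e *: X]eq_bigr do rewrite wE.
      by rewrite !big_split/= scalerDr addrACA.
    have oZ (z : I + J -> E) c : 0 <=v c -> (forall j, 0 <=v z j) -> (forall j, vort (z j) c) ->
        vort (e *: Z z) c.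
      move=> c0 z0 zc; apply/vortC/vortZ => //; [exact: ltW|exact: Z0|].
      by apply: vort_sum => // l; exact/vortC.
    have hA : sqvar (A e u) + sqvar (A e v) <= sqvar (A e w).
      apply: h => // [z z0|z c c0 z0 zc]; first by apply: A0 => //; exact: ltW.
      apply/vortC/vort_add => //; [exact: X0|exact/vleZl/Z0/z0/ltW| |exact/vortC/oZ].
      by apply: vort_sum => // l; exact/vortC.
    have hB : sqvar (B e u) + sqvar (B e v) <= sqvar (B e w).
      apply: h => // [z z0|z c c0 z0 zc]; first by apply: B0 => //; exact: ltW.
      apply/vortC/vort_add => //; [exact: Y0|exact/vleZl/Z0/z0/ltW| |exact/vortC/oZ].
      by apply: vort_sum => // l; exact/vortC.
    have sq0 z : 0 <=v z -> 0 <= sqvar z by exact: sqvar_ge0.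
    have e0' := ltW e0.
    apply: (@le_trans _ _ (\sum_i \sum_j g (u (inl i)) (u (inr j)) +
                           (* Cross terms between [u] and [v] vanish by [g_ort]; Cauchy-Schwarz and
                              superadditivity of [sqvar] join what remains. *)
                           \sum_i \sum_j g (v (inl i)) (v (inr j)))).
      rewrite -big_split/=; apply: ler_sum => i _.
      rewrite -big_split/=; apply: ler_sum => j _.
      rewrite !wE; apply: (le_trans (gDl _ _ _)) => //; first exact: vaddr_ge0.
      apply: lerD; apply: (le_trans (gDr _ _ _)) => //.
        by rewrite (g_ort (u0 _) (v0 _))// addr0.
      by rewrite (g_ort (v0 _) (u0 _)) ?add0r//; exact/vortC.
    apply: (le_trans (lerD Pu Pv)).
    apply: (le_trans (sqrt_cauchy_schwarz _ _ _ _));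
      [exact/sq0/A0|exact/sq0/B0|exact/sq0/A0|exact/sq0/B0|].
    by apply: ler_pM; rewrite ?sqrtr_ge0// ler_wsqrtr.
  have /choice[k kP] i : exists k, 0 <= k /\ (k *: Z w <=v w i /\ w i <=v (k + d) *: Z w).
    by have [k k0 kw] := nw i; exists k.
  have cd (K : finType) : (#|K| <= #|{: I + J}|)%N -> #|K|%:R * d <= e.
    move=> KIJ; rewrite /d mulrCA ger_pMr// ler_pdivrMr// mul1r ler_nat.
    exact: leqW.
  have bA : \sum_i `|w (inl i)| <= Num.sqrt (sqvar (A e w)).
    rewrite (le_trans (@sum_norm_narrow _ _ (fun i => k (inl i)) (Z w) d e _ _ _ _ _ _))//.
    - exact: Z0.
    - by move=> i; exact: (kP _).1.
    - exact: ltW.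
    - by apply: cd; rewrite card_sum leq_addr.
    - by move=> i; exact: (kP _).2.
    rewrite -[leLHS]ger0_norm// -sqrtr_sqr ler_wsqrtr// sqvar_ge//.
    by apply: A0 => //; exact: ltW.
  have bB : \sum_i `|w (inr i)| <= Num.sqrt (sqvar (B e w)).
    rewrite (le_trans (@sum_norm_narrow _ _ (fun i => k (inr i)) (Z w) d e _ _ _ _ _ _))//.
    - exact: Z0.
    - by move=> i; exact: (kP _).1.
    - exact: ltW.
    - by apply: cd; rewrite card_sum leq_addl.
    - by move=> i; exact: (kP _).2.
    rewrite -[leLHS]ger0_norm// -sqrtr_sqr ler_wsqrtr// sqvar_ge//.
    by apply: B0 => //; exact: ltW.
  apply: le_trans (ler_pM _ _ bA bB); [|by apply: sumr_ge0..].
  rewrite big_distrlr/=; apply: ler_sum => i _; apply: ler_sum => j _.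
  exact: g_norm.
pose w (k : I + J) := match k with inl i => x i | inr j => y j end.
have w0 k : 0 <=v w k by case: k.
have key (e : R) : 0 < e -> \sum_i \sum_j g (x i) (y j) <=
    M ^+ 2 * ((`|X w| + e * `|Z w|) * (`|Y w| + e * `|Z w|)).
  move=> e0; apply: (le_trans (main e e0 w w0)).
  have h z (b : R) : 0 <=v z -> `|z| <= b -> Num.sqrt (sqvar z) <= M * b.
    move=> z0 zb; apply: (@le_trans _ _ (M * `|z|)); last by rewrite ler_pM2l.
    rewrite -[leRHS]ger0_norm ?(mulr_ge0 (ltW M0))// -sqrtr_sqr ler_wsqrtr//.
    exact: sqvar_le.
  have n1 (z z' : E) : `|z + e *: z'| <= `|z| + e * `|z'|.
    by rewrite (le_trans (ler_normD _ _))// normrZ gtr0_norm.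
  have -> : M ^+ 2 * ((`|X w| + e * `|Z w|) * (`|Y w| + e * `|Z w|)) =
    (M * (`|X w| + e * `|Z w|)) * (M * (`|Y w| + e * `|Z w|)) by ring.
  apply: ler_pM; rewrite ?sqrtr_ge0//; apply: h; [apply: A0|exact: n1|apply: B0|exact: n1];
    by rewrite ?ltW.
apply/ler_addgt0Pr => e e0.
set a := `|\sum_i x i|; set b := `|\sum_j y j|; pose c := `|Z w|.
have a0 : 0 <= a by exact: normr_ge0.
have b0 : 0 <= b by exact: normr_ge0.
have c0 : 0 <= c by exact: normr_ge0.
pose K := M ^+ 2 * (a * c + c * b + c * c) + 1.
have M2 : 0 <= M ^+ 2 by exact: sqr_ge0.
have K0 : 0 < K by rewrite /K ltr_wpDl// mulr_ge0// !addr_ge0// mulr_ge0.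
(* The bound [t <= 1] lets the linear part of the error dominate the quadratic one, and [t * K <= e]
   makes both small. *)
pose t := Num.min 1 (e / K).
have t0 : 0 < t by rewrite lt_min ltr01 divr_gt0.
have t1 : t <= 1 by rewrite ge_min lexx.
have te : t * K <= e by rewrite -ler_pdivlMr// ge_min lexx orbT.
apply: (le_trans (key t t0)); rewrite -/a -/b -/c.
have -> : M ^+ 2 * ((a + t * c) * (b + t * c)) =
  M ^+ 2 * (a * b) + t * (M ^+ 2 * (a * c + c * b + t * (c * c))) by ring.
rewrite lerD2l (le_trans _ te)// ler_pM2l// /K ler_wpDr// ler_wpM2l//.
by rewrite lerD2l ler_piMl// mulr_ge0.
Qed.
End SquareVariation.

(** * The variation as a bilinear form *)

Section Partitions.
Context {R : realType} {E : banachLatticeType R}.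
Implicit Types (x y z a b c u v h : E) (r s t : seq E).

Definition vpart s x := (forall z, z \in s -> 0 <=v z) /\ \sum_(z <- s) z = x.

Definition vsubadd (f : E -> R) :=
  f 0 = 0 /\ forall a b, 0 <=v a -> 0 <=v b -> f (a + b) <= f a + f b.

Lemma vpart_ge0 s x : vpart s x -> 0 <=v x.
Proof. by move=> [s0 <-]; rewrite big_seq; exact: vsumr_ge0. Qed.

Lemma vpart1 x : 0 <=v x -> vpart [:: x] x.
Proof.
by move=> x0; split; [move=> z; rewrite inE => /eqP->|rewrite big_seq1].
Qed.

Lemma vpart_cons z s x : 0 <=v z -> vpart s x -> vpart (z :: s) (z + x).
Proof.
move=> z0 [s0 <-]; split; last by rewrite big_cons.
by move=> w; rewrite inE => /predU1P[->//|/s0].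
Qed.

Lemma vpart_behead z s x : vpart (z :: s) x -> 0 <=v z /\ vpart s (x - z).
Proof.
move=> [s0 <-]; split; first by apply: s0; rewrite mem_head.
split; first by move=> w ws; apply: s0; rewrite inE ws orbT.
by rewrite big_cons addrC addKr.
Qed.

Lemma vpart_nil x : vpart [::] x -> x = 0.
Proof. by move=> [_ <-]; rewrite big_nil. Qed.

Lemma vpart_nil0 : vpart [::] 0.
Proof. by split=> //; rewrite big_nil. Qed.

Lemma vpart_cat s t x y : vpart s x -> vpart t y -> vpart (s ++ t) (x + y).
Proof.
move=> [s0 <-] [t0 <-]; split; last by rewrite big_cat.
by move=> z; rewrite mem_cat => /orP[/s0|/t0].
Qed.

Lemma vpart_le s x z : vpart s x -> z \in s -> z <=v x.
Proof.
elim: s x => // w s IH x /vpart_behead[w0 sp]; rewrite inE => /predU1P[->|/(IH _ sp)].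
  by have := vpart_ge0 sp => h; apply: (vle_eqB h); zmod.
by move=> zx; apply: (vle_eqB (vleD zx w0)); zmod.
Qed.

Lemma vpartZ (k : R) s x : 0 <= k -> vpart s x -> vpart [seq k *: z | z <- s] (k *: x).
Proof.
move=> k0 [s0 <-]; split; last by rewrite big_map scaler_sumr.
by move=> _ /mapP[z /s0 z0 ->]; exact: vleZl.
Qed.

Lemma vsubadd_sum f s x : vsubadd f -> vpart s x -> f x <= \sum_(z <- s) f z.
Proof.
move=> [f0 fD]; elim: s x => [x /vpart_nil->|z s IH x /vpart_behead[z0 sp]].
  by rewrite big_nil f0.
rewrite big_cons; have -> : x = z + (x - z) by zmod.
by apply: le_trans (lerD (lexx _) (IH _ sp)); apply: fD => //; exact: vpart_ge0 sp.
Qed.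

Lemma vadd_eq0 x y : 0 <=v x -> 0 <=v y -> x + y = 0 -> x = 0.
Proof.
move=> x0 y0 xy; apply: vle_anti => //; apply: (vle_eqB y0).
have -> : y = (x + y) - x by zmod.
by rewrite xy; zmod.
Qed.

(** Riesz decomposition cuts each member of [r] into a part for [a] and a part for [b];
    subadditivity lets sums only grow under cutting. *)
Lemma vpart_splitD r a b : 0 <=v a -> 0 <=v b -> vpart r (a + b) ->
  exists r1 r2, [/\ vpart r1 a, vpart r2 b & forall f, vsubadd f ->
    \sum_(z <- r) f z <= \sum_(z <- r1) f z + \sum_(z <- r2) f z].
Proof.
elim: r a b => [|z r IH] a b a0 b0 rp.
  have ab := vpart_nil rp; have a_0 : a = 0 by exact: vadd_eq0 ab.
  have b_0 : b = 0 by move: ab; rewrite a_0 add0r.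
  exists [::], [::]; rewrite a_0 b_0; split; [exact: vpart_nil0..|].
  by move=> f _; rewrite !big_nil addr0.
have [z0 rp'] := vpart_behead rp.
have q0 := vpart_ge0 rp'.
have [|a1 [a2 [aE a10 a1z a20 a2q]]] := vriesz a0 z0 q0.
  by apply: (vle_eqB b0); zmod.
have za0 : 0 <=v z - a1 by exact/vle_sub0.
have [||r1 [r2 [p1 p2 h]]] := IH a2 (a + b - z - a2) a20.
- exact/vle_sub0.
- by have -> : a2 + (a + b - z - a2) = a + b - z by zmod.
exists (a1 :: r1), ((z - a1) :: r2); split.
- by rewrite aE; exact: vpart_cons.
- have -> : b = (z - a1) + (a + b - z - a2) by rewrite aE; zmod.
  exact: vpart_cons.
- move=> f fs; rewrite !big_cons addrACA; apply: lerD; last exact: h.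
  have [_ fD] := fs; have {1}-> : z = a1 + (z - a1) by zmod.
  exact: fD.
Qed.

(** A common refinement: [t] is cut successively along the members of [r]. *)
Lemma vpart_refine r t x : vpart r x -> vpart t x ->
  exists2 s, vpart s x & forall f, vsubadd f ->
    \sum_(z <- r) f z <= \sum_(z <- s) f z /\ \sum_(z <- t) f z <= \sum_(z <- s) f z.
Proof.
elim: r t x => [|z r IH] t x rp tp.
  exists t => // f [f0 fD]; split=> //; rewrite big_nil.
  move: (vpart_nil rp) tp => -> tp; have := vsubadd_sum (conj f0 fD) tp.
  by rewrite f0.
have [z0 rp'] := vpart_behead rp.
have tp' : vpart t (z + (x - z)) by have -> : z + (x - z) = x by zmod.
have [t1 [t2 [p1 p2 h]]] := vpart_splitD z0 (vpart_ge0 rp') tp'.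
have [s sp hs] := IH t2 _ rp' p2.
exists (t1 ++ s); first by rewrite -[x](subrK z) addrC; exact: vpart_cat.
move=> f fs; have [h1 h2] := hs f fs; rewrite big_cons big_cat/=; split.
  by apply: lerD => //; exact: vsubadd_sum p1.
by apply: (le_trans (h f fs)); rewrite lerD2l.
Qed.

End Partitions.

Section BilinearVariation.
Context {R : realType} {E : banachLatticeType R}.
Implicit Types (x y z a b c u v h : E) (r s t : seq E) (g : E -> E -> R).

Definition bivar_set g x y : set R := [set q | exists s r,
  [/\ vpart s x, vpart r y & q = \sum_(a <- s) \sum_(b <- r) g a b]].

Definition bivar g x y : R := sup (bivar_set g x y).

(** [subform_bound] controls all partition sums at once, so the variation is finite with the same
    constant. *)
Record bounded_subform g (K : R) : Prop := BoundedSubform {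
  subform0l : forall y, g 0 y = 0;
  subform0r : forall x, g x 0 = 0;
  subformDl : forall x x' y, 0 <=v x -> 0 <=v x' -> 0 <=v y ->
    g (x + x') y <= g x y + g x' y;
  subformDr : forall x y y', 0 <=v x -> 0 <=v y -> 0 <=v y' ->
    g x (y + y') <= g x y + g x y';
  subformZl : forall (k : R) x y, 0 <= k -> g (k *: x) y = k * g x y;
  subformZr : forall (k : R) x y, 0 <= k -> g x (k *: y) = k * g x y;
  subform_bound : forall x y s r, vpart s x -> vpart r y ->
    \sum_(a <- s) \sum_(b <- r) g a b <= K * (`|x| * `|y|)
}.

(** With [bivarC] this carries statements about the second argument over to the first. *)
Lemma bounded_subformC g K : bounded_subform g K ->
  bounded_subform (fun a b => g b a) K.
Proof.
move=> [h0l h0r hDl hDr hZl hZr hb]; split=> //.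
- by move=> x x' y *; exact: hDr.
- by move=> x y y' *; exact: hDl.
- by move=> k x y; exact: hZr.
- by move=> k x y; exact: hZl.
- by move=> x y s r sx ry; rewrite exchange_big/= [`|x| * _]mulrC; exact: hb.
Qed.

Lemma bivarC g x y : bivar (fun a b => g b a) y x = bivar g x y.
Proof.
congr sup; apply/seteqP; split=> q [s [r [sx ry ->]]];
  by exists r, s; split=> //; rewrite exchange_big.
Qed.

Section Bounded.
Variables (g : E -> E -> R) (K : R).
Hypothesis gK : bounded_subform g K.

Lemma bivar_has_sup x y : 0 <=v x -> 0 <=v y -> has_sup (bivar_set g x y).
Proof.
move=> x0 y0; split; first by exists (g x y), [:: x], [:: y]; split;
  [exact: vpart1..|rewrite !big_seq1].
by exists (K * (`|x| * `|y|)) => _ [s [r [sx ry ->]]]; exact: (subform_bound gK).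
Qed.

Lemma bivar_ge s r x y : vpart s x -> vpart r y ->
  \sum_(a <- s) \sum_(b <- r) g a b <= bivar g x y.
Proof.
move=> sx ry; apply: ub_le_sup; last by exists s, r.
exact: (bivar_has_sup (vpart_ge0 sx) (vpart_ge0 ry)).2.
Qed.

Lemma bivar_le x y (q : R) : 0 <=v x -> 0 <=v y ->
  (forall s r, vpart s x -> vpart r y -> \sum_(a <- s) \sum_(b <- r) g a b <= q) ->
  bivar g x y <= q.
Proof.
move=> x0 y0 h; apply: ge_sup; first exact: (bivar_has_sup x0 y0).1.
by move=> _ [s [r [sx ry ->]]]; exact: h.
Qed.

Lemma bivar_ge_form x y : 0 <=v x -> 0 <=v y -> g x y <= bivar g x y.
Proof.
by move=> x0 y0; have := bivar_ge (vpart1 x0) (vpart1 y0); rewrite !big_seq1.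
Qed.

Lemma bivar_norm x y : 0 <=v x -> 0 <=v y -> bivar g x y <= K * (`|x| * `|y|).
Proof. by move=> x0 y0; apply: bivar_le => // s r; exact: (subform_bound gK). Qed.

Lemma subform_sum_subadd r : (forall z, z \in r -> 0 <=v z) ->
  vsubadd (fun x => \sum_(b <- r) g (vpos x) b).
Proof.
move=> r0; split.
  by rewrite ge0_vpos ?big1//; [move=> *; exact: (subform0l gK)|exact: vle_refl].
move=> a b a0 b0; rewrite -big_split/= !big_seq; apply: ler_sum => z zr.
by rewrite !ge0_vpos//; [apply: (subformDl gK) => //; exact: r0|exact: vaddr_ge0].
Qed.

Lemma sum_vpos s x r : vpart s x ->
  \sum_(a <- s) \sum_(b <- r) g (vpos a) b = \sum_(a <- s) \sum_(b <- r) g a b.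
Proof.
by move=> [s0 _]; apply: eq_big_seq => a /s0 a0; rewrite ge0_vpos.
Qed.

Lemma bivarDr x y y' : 0 <=v x -> 0 <=v y -> 0 <=v y' ->
  bivar g x (y + y') = bivar g x y + bivar g x y'.
Proof.
move=> x0 y0 y'0; apply/eqP; rewrite eq_le; apply/andP; split.
  apply: bivar_le => //; first exact: vaddr_ge0.
  move=> s r sx ry; have [r1 [r2 [p1 p2 h]]] := vpart_splitD y0 y'0 ry.
  apply: le_trans (lerD (bivar_ge sx p1) (bivar_ge sx p2)).
  rewrite -big_split/= big_seq [leRHS]big_seq; apply: ler_sum => a aS.
  have a0 : 0 <=v a by exact: sx.1.
  have fs : vsubadd (fun b => g a (vpos b)).
    split; first by rewrite ge0_vpos ?(subform0r gK)//; exact: vle_refl.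
    by move=> b c b0 c0; rewrite !ge0_vpos//; [exact: (subformDr gK)|exact: vaddr_ge0].
  have e t z : vpart t z -> \sum_(b <- t) g a (vpos b) = \sum_(b <- t) g a b.
    by move=> [t0 _]; apply: eq_big_seq => b /t0 b0; rewrite ge0_vpos.
  by rewrite -(e _ _ ry) -(e _ _ p1) -(e _ _ p2); exact: h.
(* For the converse, near-optimal sums for [y] and [y'] may use different partitions of [x]; a
   common refinement lowers neither sum. *)
have [h h'] := (bivar_has_sup x0 y0, bivar_has_sup x0 y'0).
rewrite -sup_sumE//; apply: ge_sup.
  have [[p Sp] [q Sq]] := (h.1, h'.1).
  by exists (p + q), p => //; exists q.
move=> _ [_ [s [r [sx ry ->]]] [_ [s' [r' [sx' ry' ->]]] <-]].
have [t tx ht] := vpart_refine sx sx'.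
apply: le_trans (bivar_ge tx (vpart_cat ry ry')).
under [leRHS]eq_bigr do rewrite big_cat.
rewrite big_split/=; apply: lerD.
  rewrite -(sum_vpos _ sx) -(sum_vpos _ tx).
  exact: (ht _ (subform_sum_subadd ry.1)).1.
rewrite -(sum_vpos _ sx') -(sum_vpos _ tx).
exact: (ht _ (subform_sum_subadd ry'.1)).2.
Qed.

Lemma bivarZr_ge (k : R) x y : 0 <= k -> 0 <=v x -> 0 <=v y ->
  k * bivar g x y <= bivar g x (k *: y).
Proof.
rewrite le_eqVlt => /predU1P[<-|k0] x0 y0.
  rewrite mul0r scale0r; have := bivar_ge (vpart1 x0) vpart_nil0.
  by rewrite big_seq1 big_nil.
rewrite mulrC -ler_pdivlMr//; apply: bivar_le => // s r sx ry.
rewrite ler_pdivlMr//; have := bivar_ge sx (vpartZ (ltW k0) ry).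
rewrite mulrC mulr_sumr; apply: le_trans; apply: ler_sum => a _.
by rewrite big_map mulr_sumr; apply: ler_sum => b _; rewrite (subformZr gK)// ltW.
Qed.

Lemma bivarZr (k : R) x y : 0 <= k -> 0 <=v x -> 0 <=v y ->
  bivar g x (k *: y) = k * bivar g x y.
Proof.
rewrite le_eqVlt => /predU1P[<-|k0] x0 y0.
  have o : 0 <=v (0 : E) by exact: vle_refl.
  have := bivarDr x0 o o; rewrite addr0 scale0r mul0r => /eqP.
  by rewrite -subr_eq subrr => /eqP.
apply/eqP; rewrite eq_le (bivarZr_ge (ltW k0))// andbT.
(* The converse is the inequality already proved, for the factor [k^-1] and the element [k *: y]. *)
rewrite -ler_pdivrMl//; have := @bivarZr_ge k^-1 x (k *: y).
rewrite scalerA mulVf ?gt_eqF// scale1r; apply=> //; first by rewrite invr_ge0 ltW.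
by apply: vleZl => //; exact: ltW.
Qed.

Lemma bivar_ort x y : 0 <=v x -> 0 <=v y -> vort x y ->
  (forall a b, 0 <=v a -> 0 <=v b -> vort a b -> g a b = 0) -> bivar g x y <= 0.
Proof.
move=> x0 y0 xy g0; apply: bivar_le => // s r sx ry.
rewrite big_seq big1// => a aS; rewrite big_seq big1// => b bS.
have [a0 b0] := (sx.1 a aS, ry.1 b bS).
apply: g0 => //; apply: (vort_sub xy) => //; first exact: vpart_le sx aS.
exact: vpart_le ry bS.
Qed.
End Bounded.
End BilinearVariation.

(** * The real line as a Banach lattice, the target of scalar forms *)

Section RealLattice.
Context {R : realType}.
Definition rle (x y : R^o) : Prop := (x : R) <= y.
Definition rsup (x y : R^o) : R^o := Num.max (x : R) y.
Fact rle_refl x : rle x x. Proof. exact: lexx. Qed.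
Fact rle_anti x y : rle x y -> rle y x -> x = y.
Proof. by move=> xy yx; apply/le_anti/andP. Qed.
Fact rle_trans y x z : rle x y -> rle y z -> rle x z.
Proof. exact: le_trans. Qed.
Fact rsup_lub x y z : rle (rsup x y) z <-> rle x z /\ rle y z.
Proof. by rewrite /rle /rsup ge_max; split=> [/andP|/andP]. Qed.
Fact rleD2r z x y : rle x y -> rle (x + z) (y + z).
Proof. by rewrite /rle lerD2r. Qed.
Fact rleZ (a : R) x y : 0 <= a -> rle x y -> rle (a *: x) (a *: y).
Proof. by move=> a0 xy; exact: (ler_wpM2l a0 xy). Qed.
Fact rnorm_mono x y : rle (rsup x (- x)) (rsup y (- y)) -> `|x| <= `|y|.
Proof.
have h (z : R) : Num.max z (- z) = `|z|.
  have [z0|/ltW z0] := lerP 0 z.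
    by rewrite ger0_norm// max_l// (le_trans _ z0)// oppr_le0.
  by rewrite ler0_norm// max_r// (le_trans z0)// oppr_ge0.
by rewrite /rle /rsup !h.
Qed.
HB.instance Definition _ := isBanachLattice.Build R R^o
  rle_refl rle_anti rle_trans rsup_lub rleD2r rleZ rnorm_mono.
End RealLattice.

(** * Extending linear and bilinear maps from the positive cone *)

Section ConeExtension.
Context {R : realType} {E : banachLatticeType R}.
Implicit Types (x y z a b c : E).

Definition cone_linear (f : E -> R) :=
  (forall a b, 0 <=v a -> 0 <=v b -> f (a + b) = f a + f b) /\
  (forall (k : R) a, 0 <= k -> 0 <=v a -> f (k *: a) = k * f a).

Definition cone_ext (f : E -> R) x : R := f (vpos x) - f (vpos (- x)).

(** The extension does not depend on how an element is written as a difference of positive ones: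
    apply additivity to the two expressions of [vpos (a - b) + b]. *)
Lemma cone_extB f a b : cone_linear f -> 0 <=v a -> 0 <=v b ->
  cone_ext f (a - b) = f a - f b.
Proof.
move=> [fD _] a0 b0; have := vposBN (a - b); rewrite opprB => e.
have : f (vpos (a - b) + b) = f (vpos (b - a) + a).
  congr f; rewrite -[vpos (a - b)](subrK (vpos (b - a))) e; zmod.
rewrite !fD//; [|exact: vpos_ge0..]; rewrite /cone_ext opprB; lra.
Qed.

Lemma cone_ext_ge0 f a : cone_linear f -> 0 <=v a -> cone_ext f a = f a.
Proof.
move=> fl a0; have f0 : f 0 = 0.
  by rewrite -(scale0r (0 : E)) fl.2 ?mul0r//; exact: vle_refl.
by rewrite -[in LHS](subr0 a) cone_extB ?f0 ?subr0//; exact: vle_refl.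
Qed.

Lemma cone_ext_linear f (k : R) x y : cone_linear f ->
  cone_ext f (k *: x + y) = k * cone_ext f x + cone_ext f y.
Proof.
move=> fl; have [fD fZ] := fl.
have hD x' y' : cone_ext f (x' + y') = cone_ext f x' + cone_ext f y'.
  have -> : x' + y' = (vpos x' + vpos y') - (vpos (- x') + vpos (- y')).
    by rewrite -{1}[x']vposBN -{1}[y']vposBN; zmod.
  rewrite cone_extB// ?fD//; try by [exact: vpos_ge0|apply: vaddr_ge0; exact: vpos_ge0].
  by rewrite /cone_ext; lra.
rewrite hD; congr (_ + _).
have pZ (l : R) z : 0 <= l -> 0 <=v l *: vpos z by move=> l0; apply/vleZl/vpos_ge0.
have [k0|/ltW k0] := leP 0 k.
  rewrite -{1}[x]vposBN scalerBr cone_extB//; [|exact: pZ..].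
  by rewrite !fZ//; [rewrite /cone_ext; lra|exact: vpos_ge0..].
have nk : 0 <= - k by rewrite oppr_ge0.
have -> : k *: x = (- k) *: vpos (- x) - (- k) *: vpos x.
  by rewrite -scalerBr scaleNr -scalerN opprB vposBN.
rewrite cone_extB//; [|exact: pZ..].
by rewrite !fZ//; [rewrite /cone_ext; lra|exact: vpos_ge0..].
Qed.

Definition cone_bilinear (p : E -> E -> R) :=
  (forall y, 0 <=v y -> cone_linear (p ^~ y)) /\
  (forall x, 0 <=v x -> cone_linear (p x)).

(** Extend in the second variable, then in the first. The inner extension is a difference of two
    values of [p], so it is still linear on the cone in the first variable. *)
Lemma cone_bilinear_ext p : cone_bilinear p ->
  exists phi : {bilinear E -> E -> R^o},
    forall x y, 0 <=v x -> 0 <=v y -> phi x y = p x y.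
Proof.
move=> [pl pr]; pose f x y : R^o := cone_ext (fun a => cone_ext (p a) y) x.
have fl y : cone_linear (fun a => cone_ext (p a) y).
  split=> [a b a0 b0|k a k0 a0]; rewrite /cone_ext.
    by rewrite !(pl _ (vpos_ge0 _)).1//; lra.
  by rewrite !(pl _ (vpos_ge0 _)).2// mulrBr.
have f_bil : bilinear_for *:%R *:%R f.
  split=> [y|x] k a b; first exact: cone_ext_linear.
  have e c : f x c = cone_ext (p (vpos x)) c - cone_ext (p (vpos (- x))) c by [].
  rewrite !e.
  rewrite !cone_ext_linear; [|apply: pr; exact: vpos_ge0..].
  rewrite opprD addrACA [in RHS]/GRing.scale/= -mulrBr. by [].
pose F : {bilinear E -> E -> R^o} :=
  HB.pack f (bilinear_isBilinear.Build R E E R^o *:%R *:%R f f_bil).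
exists F => x y x0 y0; change (f x y = p x y).
by rewrite /f cone_ext_ge0// cone_ext_ge0//; exact: pr.
Qed.
End ConeExtension.

(** * Renorming by a strictly positive functional *)

Section Renorm.
Context {R : realType} {Q : banachLatticeType R}.
Implicit Types (x y z : Q).

Record norming_functional (f : Q -> R) (c : R) : Prop := NormingFunctional {
  norming_gt0 : 0 < c;
  norming_linear : forall k x y, f (k *: x + y) = k * f x + f y;
  norming_ge : forall x, 0 <=v x -> c * `|x| <= f x;
  norming_le : forall x, 0 <=v x -> f x <= `|x|
}.

Variables (f : Q -> R) (c : R).
Hypothesis fc : norming_functional f c.

(** A copy of [Q] tagged by the functional, so that it can carry a second norm. *)
Definition renormed of norming_functional f c : Type := Q.
Local Notation L := (renormed fc).

HB.instance Definition _ := GRing.Lmodule.copy L Q.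

Lemma normingD x y : f (x + y) = f x + f y.
Proof. by rewrite -[x]scale1r (norming_linear fc) mul1r scale1r. Qed.

Lemma norming0 : f 0 = 0.
Proof. by have := normingD 0 0; rewrite addr0; lra. Qed.

Lemma normingZ k x : f (k *: x) = k * f x.
Proof. by rewrite -[_ *: _]addr0 (norming_linear fc) norming0 addr0. Qed.

Lemma norming_ge0 x : 0 <=v x -> 0 <= f x.
Proof.
by move=> /(norming_ge fc); apply: le_trans; rewrite mulr_ge0// ltW// (norming_gt0 fc).
Qed.

Lemma norming_homo x y : x <=v y -> f x <= f y.
Proof.
move=> /vle_sub0/norming_ge0 h.
by rewrite -[in f y](subrK x y) normingD lerDr.
Qed.

Definition renorm_norm (x : L) : R := f (vabs (x : Q)).

Fact renorm_normD (x y : L) : renorm_norm (x + y) <= renorm_norm x + renorm_norm y.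
Proof.
rewrite /renorm_norm -normingD; apply: norming_homo; apply: vabs_le.
  by apply: vleD; exact: vle_abs.
by rewrite opprD; apply: vleD; exact: vleN_abs.
Qed.

Lemma vabsZ (k : R) x : vabs (k *: x) = `|k| *: vabs x.
Proof.
have h (l : R) z : 0 <= l -> vabs (l *: z) = l *: vabs z.
  by move=> l0; rewrite /vabs -scalerN vsupZ.
have [k0|k0] := ger0P k; first exact: h.
by rewrite -vabsN -scaleNr h// oppr_ge0 ltW.
Qed.

Fact renorm_normZ (k : R) (x : L) : renorm_norm (k *: x) = `|k| * renorm_norm x.
Proof. by rewrite /renorm_norm -normingZ; congr f; exact: vabsZ. Qed.

Lemma renorm_norm_ge (x : Q) : c * `|x| <= renorm_norm x.
Proof.
by rewrite -[`|x|]norm_vabs; apply: (norming_ge fc); exact: vabs_ge0.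
Qed.

Lemma renorm_norm_le (x : Q) : renorm_norm x <= `|x|.
Proof.
by rewrite -[leRHS]norm_vabs; apply: (norming_le fc); exact: vabs_ge0.
Qed.

Fact renorm_norm_eq0 (x : L) : renorm_norm x = 0 -> x = 0.
Proof.
move=> x0; have := renorm_norm_ge x; rewrite x0 pmulr_rle0 ?(norming_gt0 fc)//.
by rewrite normr_le0 => /eqP.
Qed.

HB.instance Definition _ := @Lmodule_isNormed.Build R L
  renorm_norm renorm_normD renorm_normZ renorm_norm_eq0.

Lemma renormedE (x : L) : `|x| = f (vabs (x : Q)). Proof. by []. Qed.

Fact renormed_cauchy_cvg (F : set_system L) : ProperFilter F -> cauchy F -> cvg F.
Proof.
move=> FF /cauchyP Fc; have c0 := norming_gt0 fc.
have /cvg_ex[/= l Fl] : cvg (F : set_system Q).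
  apply: cauchy_cvg; apply/cauchyP => e e0.
  have [x Fx] := Fc (c * e) (mulr_gt0 c0 e0); exists (x : Q).
  apply: filterS Fx => y; rewrite -!ball_normE /= => xy.
  by rewrite -(ltr_pM2l c0); apply: le_lt_trans xy; exact: renorm_norm_ge.
apply/cvg_ex; exists (l : L); apply/cvg_ballP => e e0.
have /cvg_ballP/(_ e e0) := Fl; apply: filterS => y; rewrite -!ball_normE /= => ly.
by apply: le_lt_trans ly; exact: renorm_norm_le.
Qed.

HB.instance Definition _ := Uniform_isComplete.Build L renormed_cauchy_cvg.

Definition renormed_le (x y : L) : Prop := (x : Q) <=v y.
Definition renormed_sup (x y : L) : L := vsup (x : Q) y.

Fact renormed_norm_mono (x y : L) :
  renormed_le (renormed_sup x (- x)) (renormed_sup y (- y)) -> `|x| <= `|y|.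
Proof. exact: norming_homo. Qed.

HB.instance Definition _ := isBanachLattice.Build R L
  (@vle_refl R Q) (@vle_anti R Q) (@vle_trans R Q) (@vsup_lub R Q) (@vleD2r R Q)
  (@vleZ R Q) renormed_norm_mono.

Lemma renormed_AL : AL_space L.
Proof.
move=> x y x0 y0; rewrite !renormedE -normingD; congr f.
by rewrite !ge0_vabs//; exact: vaddr_ge0.
Qed.

Lemma renormed_isomorphic : lattice_isomorphic Q L.
Proof.
have c0 := norming_gt0 fc.
have lin : linear (fun x : Q => (x : L)) by [].
pose F : {linear Q -> L} := HB.pack (fun x : Q => (x : L))
  (GRing.isLinear.Build R Q L *:%R (fun x : Q => (x : L)) lin).
exists F, (fun x => x : Q); split=> //.
  move=> x A /nbhs_ballP[e /= e0 eA]; apply/nbhs_ballP; exists e => //= y.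
  rewrite -ball_normE /= => xy; apply: eA; rewrite -ball_normE /=.
  by apply: le_lt_trans xy; exact: renorm_norm_le.
move=> x A /nbhs_ballP[e /= e0 eA]; apply/nbhs_ballP.
exists (c * e) => /=; first exact: mulr_gt0.
move=> y; rewrite -ball_normE /= => xy; apply: eA; rewrite -ball_normE /=.
by rewrite -(ltr_pM2l c0); apply: le_lt_trans xy; exact: renorm_norm_ge.
Qed.
End Renorm.

(** * Functionals on the Fremlin tensor product *)

Section PositiveBilinear.
Context {R : realType} {E F : banachLatticeType R}.
Implicit Types (x y : E).

Lemma bilinear_norm_le (phi : {bilinear E -> E -> F}) :
  (bilinear_norm phi <= 1)%E -> forall x y, `|phi x y| <= `|x| * `|y|.
Proof.
move=> phi1 x y; have [->|x0] := eqVneq x 0; first by rewrite linear0l !normr0 mul0r.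
have [->|y0] := eqVneq y 0; first by rewrite linear0r !normr0 mulr0.
have unit z : z != 0 -> `|(`|z|^-1 *: z : E)| <= 1.
  by move=> z0; rewrite normrZ normfV normr_id mulVf// normr_eq0.
have : `|phi (`|x|^-1 *: x) (`|y|^-1 *: y)| <= 1.
  rewrite -lee_fin; apply: le_trans phi1; apply: ereal_sup_ubound.
  by exists (`|x|^-1 *: x), (`|y|^-1 *: y); split=> //; exact: unit.
rewrite linearZl_LR linearZr_LR/= !normrZ !normfV !normr_id mulrA -invfM mulrC.
by rewrite ler_pdivrMr ?mul1r// mulr_gt0// normr_gt0.
Qed.

(** Expanding in positive and negative parts writes the two values as the difference and the sum of
    the same two positive elements. *)
Lemma positive_bilinear_abs (phi : {bilinear E -> E -> F}) x y :
  positive_bilinear phi -> vabs (phi x y) <=v phi (vabs x) (vabs y).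
Proof.
move=> p0; set a := vpos x; set b := vpos (- x); set c := vpos y; set d := vpos (- y).
have [a0 b0 c0 d0] : [/\ 0 <=v a, 0 <=v b, 0 <=v c & 0 <=v d] by split; exact: vpos_ge0.
have -> : phi x y = (phi a c + phi b d) - (phi a d + phi b c).
  by rewrite -{1}[x]vposBN -{1}[y]vposBN -/a -/b -/c -/d linearBl !linearBr; zmod.
have -> : phi (vabs x) (vabs y) = (phi a c + phi b d) + (phi a d + phi b c).
  by rewrite !vabsE -/a -/b -/c -/d linearDl !linearDr; zmod.
have u0 : 0 <=v phi a c + phi b d by apply: vaddr_ge0; exact: p0.
have v0 : 0 <=v phi a d + phi b c by apply: vaddr_ge0; exact: p0.
by apply: vabs_le; [apply: (vle_eqB (vaddr_ge0 v0 v0))|apply: (vle_eqB (vaddr_ge0 u0 u0))]; zmod.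
Qed.
End PositiveBilinear.

Section QuotientNorm.
Context {R : realType} {E : banachLatticeType R}.
Variable I : closedIdeal E.

Lemma norm_quot_map (x : E) : `|quot_map I x| <= `|x|.
Proof. by rewrite quot_normE; apply: ge_inf; [exists 0 => _ [y _ <-]|exists x]. Qed.

Lemma norm_quot_lift (q : bl_quot I) (e : R) : 0 < e ->
  exists2 x, quot_map I x = q & `|x| < `|q| + e.
Proof.
move=> e0; have [|_ [x xq <-] xe] :=
  @inf_adherent _ [set `|x| | x in [set x | quot_map I x = q]] e e0.
- by have [x xq] := quot_mapK q; split; [exists `|x|, x|exists 0 => _ [y _ <-]].
- by exists x.
Qed.

(** The positive part of any good lift works, since the quotient map preserves suprema. *)
Lemma norm_quot_lift_ge0 (q : bl_quot I) (e : R) : 0 <=v q -> 0 < e ->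
  exists x, [/\ 0 <=v x, quot_map I x = q & `|x| < `|q| + e].
Proof.
move=> q0 e0; have [x xq xe] := norm_quot_lift q e0; exists (vpos x); split.
- exact: vpos_ge0.
- by rewrite /vpos quot_map_vsup xq linear0; exact: ge0_vpos.
- by apply: le_lt_trans xe; exact: norm_vpos_le.
Qed.
End QuotientNorm.

Section FremlinFunctional.
Context {R : realType} {E T : banachLatticeType R}.
Variable t : {bilinear E -> E -> T}.
Hypothesis ht : fremlin_tensor t.
Implicit Types (x y : E) (u : seq (E * E)) (v w : T).

Lemma fremlin_positive : positive_bilinear t.
Proof.
move=> x y x0 y0; have := fremlin_cone ht => /(congr1 (fun A => A (t x y))) /= ->.
apply: subset_closure; exists [:: (1, t x y)]; split.
  by move=> p; rewrite inE => /eqP->; split=> //=; exists x => //; exists y.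
by rewrite big_seq1 scale1r.
Qed.

Lemma fremlin_norm_le x y : `|t x y| <= `|x| * `|y|.
Proof.
have := fremlin_isometry ht [:: (x, y)]; rewrite /bilinear_sum big_seq1/= => e.
rewrite -lee_fin e; apply: ge_ereal_sup => _ [G [phi [_ phi1 ->]]].
by rewrite /bilinear_sum big_seq1/= lee_fin; exact: bilinear_norm_le.
Qed.

Lemma fremlin_approx v (e : R) : 0 < e -> exists u, `|v - bilinear_sum t u| < e.
Proof.
move=> e0; have : closure (range (bilinear_sum t)) v by rewrite (fremlin_dense ht).
move=> /(_ (ball v e))[|_ [[u _ <-]]]; first exact: nbhsx_ballx.
by rewrite -ball_normE /= => ve; exists u.
Qed.

Lemma fremlin_cone_approx v (e : R) : 0 <=v v -> 0 < e ->
  exists s : seq (R * (E * E)),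
    (forall p, p \in s -> [/\ 0 <= p.1, 0 <=v p.2.1 & 0 <=v p.2.2]) /\
    `|v - \sum_(p <- s) p.1 *: t p.2.1 p.2.2| < e.
Proof.
move=> v0 e0; have := fremlin_cone ht => /(congr1 (fun A => A v)) /= h.
move: v0; rewrite h => /(_ (ball v e))[|_ [[s [sP ->]]]]; first exact: nbhsx_ballx.
rewrite -ball_normE /= => ve; move: ve.
set z := \sum_(p <- s) _; have [s' [s'P ->]] : exists s' : seq (R * (E * E)),
    (forall p, p \in s' -> [/\ 0 <= p.1, 0 <=v p.2.1 & 0 <=v p.2.2]) /\
    z = \sum_(p <- s') p.1 *: t p.2.1 p.2.2.
  rewrite /z {z}; elim: s sP => [_|p s IH sP].
    by exists [::]; split=> //; rewrite !big_nil.
  have [|s' [s'P s'E]] := IH; first by move=> q qs; apply: sP; rewrite inE qs orbT.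
  have [|p0 [x x0 [y y0 txy]]] := sP p; first by rewrite mem_head.
  exists ((p.1, (x, y)) :: s'); split; last by rewrite !big_cons s'E -txy.
  by move=> q; rewrite inE => /predU1P[->//|/s'P].
by move=> ve; exists s'.
Qed.

Variable phi : {bilinear E -> E -> R^o}.
Hypothesis phi0 : positive_bilinear phi.
Hypothesis phi_le : forall x y, 0 <=v x -> 0 <=v y -> (phi x y : R) <= `|x| * `|y|.

Lemma form_norm_le x y : `|phi x y| <= `|x| * `|y|.
Proof.
have h := positive_bilinear_abs x y phi0.
have p0 := vabs_ge0 (phi x y).
have := norm_le_ge0 p0 h; rewrite norm_vabs => /le_trans; apply.
rewrite ger0_norm; last exact: (phi0 (vabs_ge0 x) (vabs_ge0 y)).
by rewrite -(norm_vabs x) -(norm_vabs y); apply: phi_le; exact: vabs_ge0.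
Qed.

(** [phi], with the real line as target, is one of the competitors in the supremum that defines the
    Fremlin norm. *)
Lemma form_sum_le u : `|(bilinear_sum phi u : R)| <= `|bilinear_sum t u|.
Proof.
rewrite -lee_fin (fremlin_isometry ht); apply: ereal_sup_ubound.
exists R^o, phi; split=> //; apply: ge_ereal_sup => _ [x [y [x1 y1 ->]]].
by rewrite lee_fin (le_trans (form_norm_le _ _))// mulr_ile1.
Qed.

Definition sum_scale (k : R) u := [seq (k *: p.1, p.2) | p <- u].

Lemma bilinear_sum_scale (G : banachLatticeType R) (psi : {bilinear E -> E -> G}) k u u' :
  bilinear_sum psi (sum_scale k u ++ u') = k *: bilinear_sum psi u + bilinear_sum psi u'.
Proof.
rewrite /bilinear_sum big_cat big_map/= scaler_sumr; congr (_ + _).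
by apply: eq_bigr => p _; rewrite linearZl_LR.
Qed.

Lemma form_dist_le u u' :
  `|(bilinear_sum phi u : R) - bilinear_sum phi u'| <= `|bilinear_sum t u - bilinear_sum t u'|.
Proof.
have := form_sum_le (sum_scale (-1) u' ++ u).
rewrite !bilinear_sum_scale !scaleN1r => h.
by rewrite [leRHS](_ : _ = `|- bilinear_sum t u' + bilinear_sum t u|) 1?addrC// [in leLHS]addrC.
Qed.

(** By [form_dist_le] the values of [phi] on lists are a 1-Lipschitz function of the represented
    tensors, which are dense. [S] is a McShane-type extension; linearity follows by approximation
    through [SP]. *)
Lemma form_extends : exists F : T -> R,
  [/\ forall k v w, F (k *: v + w) = k * F v + F w,
      forall x y, F (t x y) = phi x y & forall v, `|F v| <= `|v|].
Proof.
pose S v : R^o := sup [set ((bilinear_sum phi u : R) - `|v - bilinear_sum t u|) | u in setT].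
have SP v u : `|S v - bilinear_sum phi u| <= `|v - bilinear_sum t u|.
  have ub u' u'' : (bilinear_sum phi u' : R) - `|v - bilinear_sum t u'| <=
      bilinear_sum phi u'' + `|v - bilinear_sum t u''|.
    have h1 : (bilinear_sum phi u' : R) - bilinear_sum phi u'' <=
        `|bilinear_sum t u' - bilinear_sum t u''|.
      by apply: le_trans (form_dist_le _ _); exact: ler_norm.
    have h2 : `|bilinear_sum t u' - bilinear_sum t u''| <=
        `|v - bilinear_sum t u'| + `|v - bilinear_sum t u''|.
      rewrite [X in _ <= X + _]distrC; apply: le_trans (ler_normD _ _).
      by rewrite addrA subrK.
    rewrite lerBlDr -addrA -lerBlDl [leRHS]addrC; exact: le_trans h1 h2.
  rewrite ler_distl; apply/andP; split.
    apply: ub_le_sup; last by exists u.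
    by exists (bilinear_sum phi [::] + `|v - bilinear_sum t [::]|) => _ [u' _ <-].
  apply: ge_sup; first by exists ((bilinear_sum phi u : R) - `|v - bilinear_sum t u|), u.
  by move=> _ [u' _ <-].
exists S; split=> [k v w|x y|v].
- apply/eqP; rewrite -subr_eq0 -normr_le0; apply/ler_addgt0Pr => e e0; rewrite add0r.
  (* Linearity is tested on approximations within [d]; the error [|k| * d + d] occurs twice. *)
  pose d := e / (2 * (`|k| + 1)).
  have k1 : 0 < 2 * (`|k| + 1) by rewrite mulr_gt0// ltr_wpDl.
  have d0 : 0 < d by exact: divr_gt0.
  have [u /ltW vu] := fremlin_approx v d0; have [u' /ltW wu'] := fremlin_approx w d0.
  have h1 := le_trans (SP v u) vu; have h2 := le_trans (SP w u') wu'.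
  have := SP (k *: v + w) (sum_scale k u ++ u').
  rewrite !bilinear_sum_scale => h3.
  have h4 : `|S (k *: v + w) - (k *: bilinear_sum phi u + bilinear_sum phi u')| <= `|k| * d + d.
    apply: (le_trans h3).
    rewrite (_ : _ - _ = k *: (v - bilinear_sum t u) + (w - bilinear_sum t u')).
      by rewrite (le_trans (ler_normD _ _))// normrZ lerD// ler_wpM2l.
    by rewrite scalerBr opprD addrACA.
  have -> : S (k *: v + w) - (k * S v + S w) =
    (S (k *: v + w) - (k *: bilinear_sum phi u + bilinear_sum phi u')) -
    (k * (S v - bilinear_sum phi u) + (S w - bilinear_sum phi u')).
    by rewrite /GRing.scale/=; ring.
  rewrite (le_trans (ler_normB _ _))//.
  have -> : e = (`|k| * d + d) + (`|k| * d + d) by rewrite /d; field; rewrite gt_eqF// ltr_wpDl.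
  apply: lerD => //; rewrite (le_trans (ler_normD _ _))// normrM lerD// ler_wpM2l//.
- have := SP (t x y) [:: (x, y)]; rewrite /bilinear_sum !big_seq1/= subrr normr0.
  by rewrite normr_le0 subr_eq0 => /eqP.
- by have := SP v [::]; rewrite /bilinear_sum !big_nil !subr0.
Qed.
End FremlinFunctional.

(** * The norming functional on the quotient *)

Section DiagonalQuotient.
Context {R : realType} {E T : banachLatticeType R}.
Variables (t : {bilinear E -> E -> T}) (M : R).
Hypothesis ht : fremlin_tensor t.
Hypothesis M0 : 0 < M.
Hypothesis hE : lower_2_estimate E M.
Implicit Types (x y : E) (v w : T).

Let C := M ^+ 2.
Let C0 : 0 < C. Proof. exact: exprn_gt0. Qed.

Definition diag_form x y : R := C^-1 * `|quot_map (Ioc t) (t x y)|.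

Lemma quot_map_ort x y : 0 <=v x -> 0 <=v y -> vort x y ->
  quot_map (Ioc t) (t x y) = 0.
Proof.
move=> x0 y0 /(vort_disjoint x0 y0) xy; apply/quot_map_eq0 => J [_ _]; apply.
by exists x, y.
Qed.

(** The last field is [sum_form_le] for the norm of the class of [t x y]; the factor [C^-1] cancels
    [M ^+ 2] and leaves the constant 1. *)
Lemma diag_form_bounded : bounded_subform diag_form 1.
Proof.
have Ci : 0 <= C^-1 by rewrite invr_ge0 ltW.
split.
- by move=> y; rewrite /diag_form linear0l linear0 normr0 mulr0.
- by move=> x; rewrite /diag_form linear0r linear0 normr0 mulr0.
- move=> x x' y _ _ _; rewrite /diag_form linearDl linearD -mulrDr ler_wpM2l//.
  exact: ler_normD.
- move=> x y y' _ _ _; rewrite /diag_form linearDr linearD -mulrDr ler_wpM2l//.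
  exact: ler_normD.
- move=> k x y k0; rewrite /diag_form linearZl_LR linearZ/= normrZ ger0_norm//.
  by rewrite mulrCA.
- move=> k x y k0; rewrite /diag_form linearZr_LR linearZ/= normrZ ger0_norm//.
  by rewrite mulrCA.
move=> x y s r [s0 sx] [r0 ry]; rewrite mul1r /diag_form.
under eq_bigr do rewrite -mulr_sumr.
rewrite -mulr_sumr mulrC ler_pdivrMr// mulrC.
rewrite (big_nth 0) big_mkord.
under eq_bigr do rewrite (big_nth 0) big_mkord.
have sE : x = \sum_(i < size s) s`_i by rewrite -sx (big_nth 0) big_mkord.
have rE : y = \sum_(i < size r) r`_i by rewrite -ry (big_nth 0) big_mkord.
rewrite sE rE.
apply: (@sum_form_le _ _ M M0 hE (fun x y => `|quot_map (Ioc t) (t x y)|)).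
- by move=> a a2 b _ _ _; rewrite linearDl linearD; exact: ler_normD.
- by move=> a b b2 _ _ _; rewrite linearDr linearD; exact: ler_normD.
- by move=> a b; apply: le_trans (fremlin_norm_le ht a b); exact: norm_quot_map.
- by move=> a b a0 b0 ab; rewrite quot_map_ort// normr0.
- by move=> i; apply: s0; exact: mem_nth.
- by move=> i; apply: r0; exact: mem_nth.
Qed.


Lemma diag_form_bilinear : cone_bilinear (bivar diag_form).
Proof.
have gK := diag_form_bounded; have gK' := bounded_subformC gK.
split=> x x0; split=> [a b a0 b0|k a k0 a0].
- by rewrite -!(bivarC diag_form _ x) (bivarDr gK').
- by rewrite -!(bivarC diag_form _ x) (bivarZr gK').
- by rewrite (bivarDr gK).
- by rewrite (bivarZr gK).
Qed.

(** [F] extends the variation of [diag_form]. The lower bound holds on elementary positive tensors,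
    passes to positive combinations by the triangle inequality, and to the whole cone by
    approximation. *)
Lemma diag_functional : exists F : T -> R,
  [/\ forall k v w, F (k *: v + w) = k * F v + F w,
      forall v, `|F v| <= `|v|,
      forall v, 0 <=v v -> C^-1 * `|quot_map (Ioc t) v| <= F v &
      forall v, ideal_set (Ioc t) v -> F v = 0].
Proof.
have gK := diag_form_bounded.
have [phi phiE] := cone_bilinear_ext diag_form_bilinear.
have Ci : 0 <= C^-1 by rewrite invr_ge0 ltW.
have phi_ge x y : 0 <=v x -> 0 <=v y -> diag_form x y <= phi x y.
  by move=> x0 y0; rewrite phiE//; exact: (bivar_ge_form gK).
have phi0 : positive_bilinear phi.
  move=> x y x0 y0; apply: (@le_trans _ _ (diag_form x y)); last exact: phi_ge.
  by rewrite mulr_ge0.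
have phi_le x y : 0 <=v x -> 0 <=v y -> (phi x y : R) <= `|x| * `|y|.
  by move=> x0 y0; rewrite phiE// -[leRHS]mul1r; exact: (bivar_norm gK).
have [F [Flin Ft Fle]] := form_extends ht phi0 phi_le.
have FD v w : F (v + w) = F v + F w by rewrite -[v]scale1r Flin mul1r scale1r.
have F0 : F 0 = 0 by apply/eqP; rewrite -normr_le0 -(normr0 T).
have FZ k v : F (k *: v) = k * F v by rewrite -[_ *: _]addr0 Flin F0 addr0.
have FB v w : F (v - w) = F v - F w by rewrite FD -scaleN1r FZ mulN1r.
have Fge v : 0 <=v v -> C^-1 * `|quot_map (Ioc t) v| <= F v.
  move=> v0; apply/ler_addgt0Pr => e e0.
  (* Replacing [v] by [z] costs [d] in [F] and [C^-1 * d] in the quotient norm, together [e]. *)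
  pose d := e / (1 + C^-1).
  have c1 : 0 < 1 + C^-1 by rewrite ltr_wpDr.
  have d0 : 0 < d by exact: divr_gt0.
  have [s [sP /ltW vs]] := fremlin_cone_approx ht v0 d0.
  set z := \sum_(p <- s) _ in vs.
  have h1 : C^-1 * `|quot_map (Ioc t) z| <= F z.
    rewrite /z; have Fs : F z = \sum_(p <- s) p.1 * F (t p.2.1 p.2.2).
      by rewrite /z; elim: (s) => [|p r IH]; rewrite ?big_nil// !big_cons FD FZ IH.
    rewrite -/z Fs /z linear_sum.
    apply: (@le_trans _ _ (C^-1 * \sum_(p <- s) `|quot_map (Ioc t) (p.1 *: t p.2.1 p.2.2)|)).
      by rewrite ler_wpM2l// ler_norm_sum.
    rewrite mulr_sumr !big_seq; apply: ler_sum => p ps; have [p0 x0 y0] := sP p ps.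
    rewrite linearZ/= normrZ (ger0_norm p0) mulrCA ler_wpM2l// Ft.
    exact: phi_ge.
  have h2 : F z - F v <= d.
    by rewrite -FB (le_trans (ler_norm _))// (le_trans (Fle _))// distrC.
  have h3 : C^-1 * `|quot_map (Ioc t) v| <= C^-1 * `|quot_map (Ioc t) z| + C^-1 * d.
    have qv : quot_map (Ioc t) v = quot_map (Ioc t) z + quot_map (Ioc t) (v - z).
      by rewrite -linearD addrC subrK.
    rewrite -mulrDr ler_wpM2l// qv (le_trans (ler_normD _ _))// lerD2l.
    exact: (le_trans (norm_quot_map (Ioc t) (v - z)) vs).
  have dE : e = d + C^-1 * d by rewrite -[X in X + _]mul1r -mulrDl mulrC divfK// gt_eqF.
  rewrite (le_trans h3)// dE addrA lerD2r (le_trans h1)//.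
  by rewrite addrC -lerBlDr.
exists F; split=> // v Iv.
have Fpos w : 0 <=v w -> 0 <= F w.
  by move=> /Fge; apply: le_trans; rewrite mulr_ge0.
have Fhomo u w : u <=v w -> F u <= F w by move=> /vle_sub0/Fpos; rewrite FB subr_ge0.
have Fabs w : `|F w| <= F (vabs w).
  have FN : F (- w) = - F w by rewrite -scaleN1r FZ mulN1r.
  by rewrite ler_norml lerNl -FN !Fhomo//; [exact: vle_abs|exact: vleN_abs].
suff F1 : F (vabs v) = 0 by apply/eqP; rewrite -normr_le0 -F1.
(* The elements on whose modulus [F] vanishes form a closed order ideal; it contains the generators,
   hence all of [Ioc t]. *)
apply: (Iv [set w | F (vabs w) = 0]); split.
- split=> /=.
  + by rewrite ge0_vabs//; exact: vle_refl.
  + move=> a w w' Fw Fw'; apply/eqP; rewrite eq_le Fpos ?andbT; last exact: vabs_ge0.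
    apply: (@le_trans _ _ (F (`|a| *: vabs w + vabs w'))); last by rewrite Flin Fw Fw' mulr0 addr0.
    apply: Fhomo; rewrite -vabsZ; apply: vabs_le; first by apply: vleD; exact: vle_abs.
    by rewrite opprD; apply: vleD; exact: vleN_abs.
  + move=> w w' ww Fw'; apply/eqP; rewrite eq_le Fpos ?andbT; last exact: vabs_ge0.
    by rewrite -Fw'; exact: Fhomo.
- move=> w cw; apply/eqP; rewrite eq_le Fpos ?andbT; last exact: vabs_ge0.
  apply/ler_addgt0Pr => e e0; rewrite add0r.
  have [|w' [Fw']] := cw (ball w e); first exact: nbhsx_ballx.
  rewrite -ball_normE /= => /ltW we.
  rewrite -[leLHS]subr0 -[in X in _ - X]Fw' -FB (le_trans (ler_norm _))// (le_trans (Fle _))//.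
  by apply: le_trans we; exact: norm_vabsB.
- move=> _ [x [y [xy ->]]]; apply/eqP; rewrite eq_le Fpos ?andbT; last exact: vabs_ge0.
  (* The modulus of [t x y] lies below the tensor of the moduli, on which [F] is the variation at a
     disjoint pair, at most 0 by [bivar_ort]. *)
  apply: (le_trans (Fhomo _ _ (positive_bilinear_abs x y (fremlin_positive ht)))).
  rewrite Ft phiE; [|exact: vabs_ge0..]; apply: (bivar_ort gK _ _ xy); [exact: vabs_ge0..|].
  by move=> a b a0 b0 ab; rewrite /diag_form quot_map_ort// normr0 mulr0.
Qed.

(** As [F] vanishes on [Ioc t], its value at any representative depends only on the class, so an
    arbitrary choice [lift] defines it on the quotient. *)
Lemma diag_quotient_norming : exists F : bl_quot (Ioc t) -> R,
  norming_functional F (M ^- 2).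
Proof.
have [F [Flin Fle Fge FI]] := diag_functional.
have /choice[lift liftE] q := @quot_mapK _ _ (Ioc t) q.
have Flift v : F (lift (quot_map (Ioc t) v)) = F v.
  have /FI : ideal_set (Ioc t) (lift (quot_map (Ioc t) v) - v).
    by apply/quot_map_eq; rewrite liftE.
  by rewrite addrC -scaleN1r Flin mulN1r addrC => /eqP; rewrite subr_eq0 => /eqP.
exists (F \o lift); split=> /=.
- by rewrite invr_gt0.
- by move=> k p q; rewrite -Flin -[RHS]Flift linearP/= !liftE.
- move=> q /quot_vleE[v v0 vq]; rewrite subr0 in vq.
  by rewrite -vq Flift; exact: Fge.
(* The quotient norm is an infimum, so a representative of almost minimal norm is used. *)
- move=> q q0; apply/ler_addgt0Pr => e e0.
  have [v [v0 <- /ltW ve]] := norm_quot_lift_ge0 q0 e0.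
  by rewrite Flift (le_trans _ ve)// (le_trans (ler_norm _)).
Qed.
End DiagonalQuotient.

Theorem corollary17 (R : realType) (E T : banachLatticeType R)
    (t : {bilinear E -> E -> T}) (M : R) :
  fremlin_tensor t ->
  0 < M -> lower_2_estimate E M ->
  (exists L : banachLatticeType R,
     AL_space L /\ lattice_isomorphic (bl_quot (Ioc t)) L) /\
  (M = 1 -> AL_space (bl_quot (Ioc t))).
Proof.
move=> ht M0 hE; have [F Fn] := diag_quotient_norming ht M0 hE; split.
  by exists (renormed Fn); split; [exact: renormed_AL|exact: renormed_isomorphic].
move=> M1 p q p0 q0.
(* For [M = 1] the lower and upper bounds on [F] coincide, so the quotient norm itself is additive
   on the cone. *)
have normF r : 0 <=v r -> `|r| = F r.
  move=> r0; apply/eqP; rewrite eq_le (norming_le Fn)// andbT.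
  by have := norming_ge Fn r0; rewrite M1 expr1n invr1 mul1r.
rewrite (normF p)// (normF q)// (normF (p + q)); last exact: vaddr_ge0.
exact: (normingD Fn).
Qed.
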